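(* Suppose that $\mathcal K^*=\{\{p\},\emptyset\}$. Consider the following 4 cases. Case 1. $K^*$ minimizes $AIC(K)$ with respect to $K\in\mathcal K^*$. Define $d=\sqrt{\left(\exp\left(\frac{2f(n)}{n}\right)-1\right)(n-p)}$. Case 2. $K^*$ minimizes $C_K$ with respect to $K\in\mathcal K^*$. Define $d=\sqrt2$. Case 3. $K^*$ minimizes $B_K$ with respect to $K\in\mathcal K^*$. Define $d=1$. Case 4. For a given critical value $d>0$: if $|T|\ge d$ then $K^*=\emptyset$; otherwise $K^*=\{p\}$. In each of these 4 cases, the coverage probability $P(\theta\in I(K^* ))$ of the confidence interval $I(K^* )$ is an even function of $\gamma$ and is equal to $$(1-\alpha)+\int_0^\infty\int_{-d}^{d}\big(k(wx,w,\gamma,\rho)-k^\dagger(wx,w,\gamma,\rho)\big)\,\phi(wx-\gamma)\,w\,f_W(w)\,dx\,dw,$$ where $\phi$ denotes the $N(0,1)$ probability density function and $f_W$ denotes the probability density function of $W$. Moreover, for given $\gamma$, this expression is an even function of $\rho$.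
   Context: Model: $Y=X\beta+\varepsilon$, where $X$ is a known $n\times p$ matrix with linearly independent columns, $n>p$, $\beta\in\mathbb R^p$ is unknown, $\varepsilon\sim N(0,\sigma^2I_n)$ and $\sigma^2>0$ is unknown. The quantity of interest is $\theta=a^T\beta$ with $a\in\mathbb R^p$, $a\ne0$, known. Fix $\alpha\in(0,1)$. An integer $q$ with $1\le q<p$ is given. Let $\hat\beta$ be the least squares estimator of $\beta$, $\hat\Theta=a^T\hat\beta$, and $RSS=(Y-X\hat\beta)^T(Y-X\hat\beta)$. For $K\subset\{q+1,\dots,p\}$, $|K|$ is the number of elements of $K$; $\hat\beta_K$ is the least squares estimator of $\beta$ subject to $\beta_i=0$ for all $i\in K$ (so $\hat\beta_\emptyset=\hat\beta$); $RSS_K=(Y-X\hat\beta_K)^T(Y-X\hat\beta_K)$; $S_K^2=RSS_K/(n-p+|K|)$; $v(K)=\mathrm{Var}(a^T\hat\beta_K)/\sigma^2$. Let $t(m)$ be defined by $P(-t(m)\le \tau\le t(m))=1-\alpha$ for $\tau$ having Student's $t$ distribution with $m$ degrees of freedom. Define $$I(K)=\big[a^T\hat\beta_K-d_K,\ a^T\hat\beta_K+d_K\big],\qquad d_K=t(n-p+|K|)\,S_K\sqrt{v(K)};$$ for a data-dependent set $K^*$, $I(K^* )$ is $I(K)$ evaluated at $K=K^*$. Criteria: $AIC(K)=n\ln(RSS_K)+2(p-|K|)f(n)$, where $f(n)=1$ (AIC) or $f(n)=\frac12\ln n$ (BIC); $C_K=\dfrac{RSS_K}{RSS/(n-p)}-n+2(p-|K|)$;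 $B_K=\dfrac{RSS_K}{n-p+|K|}$. Ties occur with probability zero and are immaterial. Let $V=(v_{ij})$ be the $2\times2$ covariance matrix of $(\hat\Theta,\hat\beta_p)$ divided by $\sigma^2$; $\rho=\mathrm{Corr}(\hat\Theta,\hat\beta_p)=v_{12}/\sqrt{v_{11}v_{22}}$ (the indices $q+1,\dots,p$ are labelled so that $|\mathrm{Corr}(\hat\Theta,\hat\beta_j)|$ is maximized over $j\in\{q+1,\dots,p\}$ at $j=p$); $\gamma=\beta_p/(\sigma\sqrt{v_{22}})$; $T=\hat\beta_p/\big(\sqrt{RSS/(n-p)}\sqrt{v_{22}}\big)$; and $W=\sqrt{RSS/((n-p)\sigma^2)}$, which is distributed as $\sqrt{Q/(n-p)}$ with $Q\sim\chi^2_{n-p}$. Define $$\ell_1(w)=-t(n-p)w,\qquad u_1(w)=t(n-p)w,$$ $$\ell_2(h,w,\rho)=\rho h-t(n-p+1)\sqrt{\tfrac{(n-p)w^2+h^2}{n-p+1}}\sqrt{1-\rho^2},\qquad u_2(h,w,\rho)=\rho h+t(n-p+1)\sqrt{\tfrac{(n-p)w^2+h^2}{n-p+1}}\sqrt{1-\rho^2},$$ $$k^\dagger(h,w,\gamma,\rho)=\Psi\big(\ell_1(w),u_1(w);\rho(h-\gamma),1-\rho^2\big),\qquad k(h,w,\gamma,\rho)=\Psi\big(\ell_2(h,w,\rho),u_2(h,w,\rho);\rho(h-\gamma),1-\rho^2\big),$$ where $\Psi(x,y;\mu,v)=P(x\le Z\le y)$ for $Z\sim N(\mu,v)$ (with $N(\mu,0)$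 the point mass at $\mu$). *)

(* Defs.v *)
From HB Require Import structures.
From mathcomp Require Import all_boot all_order all_algebra.
From mathcomp Require Import all_classical all_reals all_analysis.

Set Implicit Arguments.
Unset Strict Implicit.
Unset Printing Implicit Defensive.

Import Order.TTheory GRing.Theory Num.Theory.
Import numFieldNormedType.Exports.

Local Open Scope classical_set_scope.
Local Open Scope ring_scope.

(* N(mu, v) with v the variance.  The case v = 0 is separate because
   normal_prob mu 0 is the uniform law on [0, 1], not a point mass. *)
Definition normal_law (R : realType) (mu v : R) : set R -> \bar R :=
  if v == 0 then (\d_mu : set R -> \bar R) else normal_prob mu (Num.sqrt v).

Definition Psi (R : realType) (x y mu v : R) : R :=
  fine (normal_law mu v `[x, y]).

Definition add_sqr (R : realType)
    (z : measurableTypeR R * measurableTypeR R) : measurableTypeR R :=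
  z.1 ^+ 2 + z.2.

Lemma measurable_add_sqr (R : realType) : measurable_fun setT (@add_sqr R).
Proof.
apply: measurable_realfun.measurable_funD; last exact: measurable_snd.
by apply: measurable_realfun.measurable_funX; exact: measurable_fst.
Qed.

HB.instance Definition _ (R : realType) :=
  isMeasurableFun.Build _ _ _ _ (@add_sqr R) (@measurable_add_sqr R).

(* The chi-squared law with m degrees of freedom, i.e. the law of
   Z_1^2 + ... + Z_m^2 with Z_1, ..., Z_m independent N(0, 1). *)
Fixpoint chi2_law (R : realType) (m : nat) : probability (measurableTypeR R) R :=
  if m is m'.+1
  then distribution (normal_prob (0 : R) 1 \x chi2_law R m')%E [the {mfun _ >-> _} of @add_sqr R]
  else @dirac _ (measurableTypeR R) 0 R.

(* The law of Z / sqrt (Q / m) with Z ~ N(0, 1) and Q ~ chi^2_m independent. *)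
Definition student_law (R : realType) (m : nat) : set R -> \bar R :=
  pushforward (normal_prob (0 : R) 1 \x chi2_law R m)%E
    (fun z : R * R => z.1 / Num.sqrt (z.2 / m%:R)).

Definition is_pdf (d : measure_display) (T : measurableType d) (R : realType)
    (P : probability T R) (U : T -> R) (f : R -> R) : Prop :=
  [/\ measurable_fun [set: R] f,
      forall x, 0 <= f x &
      forall A : set R, measurable A ->
        P (U @^-1` A) = (\int[lebesgue_measure]_(x in A) (f x)%:E)%E].

Definition mutually_independent (d : measure_display) (T : measurableType d)
    (R : realType) (P : probability T R) (n : nat) (U : 'I_n -> T -> R) : Prop :=
  forall (J : {set 'I_n}) (A : 'I_n -> set R),
    (forall i, measurable (A i)) ->
    P [set w | forall i, i \in J -> A i (U i w)] =
      (\prod_(i in J) P (U i @^-1` A i))%E.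

Definition cov (d : measure_display) (T : measurableType d) (R : realType)
    (P : probability T R) (U V : T -> R) : R := fine (covariance P U V).

Definition corr (d : measure_display) (T : measurableType d) (R : realType)
    (P : probability T R) (U V : T -> R) : R :=
  cov P U V / Num.sqrt (cov P U U * cov P V V).

Definition dot (R : realType) (m : nat) (u v : 'cV[R]_m) : R :=
  (u^T *m v) 0 0.

Definition sum_sq (R : realType) (n p : nat) (X : 'M[R]_(n, p))
    (y : 'cV[R]_n) (b : 'cV[R]_p) : R :=
  dot (y - X *m b) (y - X *m b).

Definition is_lse (R : realType) (n p : nat) (X : 'M[R]_(n, p))
    (K : {set 'I_p}) (y : 'cV[R]_n) (b : 'cV[R]_p) : Prop :=
  (forall i, i \in K -> b i 0 = 0) /\
  (forall c : 'cV[R]_p, (forall i, i \in K -> c i 0 = 0) ->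
     sum_sq X y b <= sum_sq X y c).

(* The minimizer exists and is unique when X has full column rank. *)
Definition lse (R : realType) (n p : nat) (X : 'M[R]_(n, p))
    (K : {set 'I_p}) (y : 'cV[R]_n) : 'cV[R]_p :=
  xget 0 [set b | is_lse X K y b].

Definition RSS (R : realType) (n p : nat) (X : 'M[R]_(n, p))
    (K : {set 'I_p}) (y : 'cV[R]_n) : R := sum_sq X y (lse X K y).

Definition S_ (R : realType) (n p : nat) (X : 'M[R]_(n, p))
    (K : {set 'I_p}) (y : 'cV[R]_n) : R :=
  Num.sqrt (RSS X K y / (n - p + #|K|)%:R).

Inductive penalty := AIC | BIC.

Definition penalty_factor (R : realType) (pen : penalty) (n : nat) : R :=
  match pen with AIC => 1 | BIC => 2^-1 * ln n%:R end.

Definition AIC_crit (R : realType) (n p : nat) (X : 'M[R]_(n, p))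
    (pen : penalty) (y : 'cV[R]_n) (K : {set 'I_p}) : R :=
  n%:R * ln (RSS X K y) + 2 * (p - #|K|)%:R * penalty_factor R pen n.

Definition C_crit (R : realType) (n p : nat) (X : 'M[R]_(n, p))
    (y : 'cV[R]_n) (K : {set 'I_p}) : R :=
  RSS X K y / (RSS X finset.set0 y / (n - p)%:R) - n%:R + 2 * (p - #|K|)%:R.

Definition B_crit (R : realType) (n p : nat) (X : 'M[R]_(n, p))
    (y : 'cV[R]_n) (K : {set 'I_p}) : R :=
  RSS X K y / (n - p + #|K|)%:R.

Definition minimizes (R : realType) (I : finType) (F : {set I})
    (crit : I -> R) (K : I) : Prop :=
  K \in F /\ forall K', K' \in F -> crit K <= crit K'.

(* The unknown parameters (beta, sigma), and a probability space carrying
   errors eps ~ N(0, sigma^2 I_n). *)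
Record gauss_model (R : realType) (n p : nat) (X : 'M[R]_(n, p)) := GaussModel {
  disp : measure_display ;
  Omega : measurableType disp ;
  Pr : probability Omega R ;
  beta : 'cV[R]_p ;
  sigma : R ;
  eps : 'I_n -> {RV Pr >-> R} ;
  sigma_gt0 : 0 < sigma ;
  eps_normal : forall i (A : set R), measurable A ->
    distribution Pr (eps i) A = normal_prob 0 sigma A ;
  eps_indep : mutually_independent Pr (fun i => eps i : Omega -> R)
}.

Section Model.
Context (R : realType) (n p : nat) (X : 'M[R]_(n, p)) (M : gauss_model X).
Context (a : 'cV[R]_p).

Definition Y (w : Omega M) : 'cV[R]_n := X *m beta M + \col_i eps M i w.

Definition theta : R := dot a (beta M).

Definition Theta_hat (K : {set 'I_p}) (w : Omega M) : R :=
  dot a (lse X K (Y w)).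

Definition beta_hat (j : 'I_p) (w : Omega M) : R := lse X finset.set0 (Y w) j 0.

Definition vK (K : {set 'I_p}) : R :=
  cov (Pr M) (Theta_hat K) (Theta_hat K) / sigma M ^+ 2.

Definition CI (t : nat -> R) (K : {set 'I_p}) (w : Omega M) : set R :=
  let dK := t (n - p + #|K|)%N * S_ X K (Y w) * Num.sqrt (vK K) in
  `[Theta_hat K w - dK, Theta_hat K w + dK].

Definition coverage (t : nat -> R) (Kstar : Omega M -> {set 'I_p}) : \bar R :=
  Pr M [set w | CI t (Kstar w) w theta].

(* In what follows l is the index of the last coefficient, "beta_p". *)
Definition v11 : R :=
  cov (Pr M) (Theta_hat finset.set0) (Theta_hat finset.set0) / sigma M ^+ 2.
Definition v12 (l : 'I_p) : R :=
  cov (Pr M) (Theta_hat finset.set0) (beta_hat l) / sigma M ^+ 2.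
Definition v22 (l : 'I_p) : R :=
  cov (Pr M) (beta_hat l) (beta_hat l) / sigma M ^+ 2.

Definition rho (l : 'I_p) : R := v12 l / Num.sqrt (v11 * v22 l).

Definition gamma (l : 'I_p) : R :=
  beta M l 0 / (sigma M * Num.sqrt (v22 l)).

Definition T_stat (l : 'I_p) (w : Omega M) : R :=
  beta_hat l w /
    (Num.sqrt (RSS X finset.set0 (Y w) / (n - p)%:R) * Num.sqrt (v22 l)).

Definition W (w : Omega M) : R :=
  Num.sqrt (RSS X finset.set0 (Y w) / ((n - p)%:R * sigma M ^+ 2)).

(* 0-based: the 1-based indices q+1, ..., p are the j : 'I_p with q <= j. *)
Definition last_max_corr (q : nat) (l : 'I_p) : Prop :=
  forall j : 'I_p, (q <= j)%N ->
    `|corr (Pr M) (Theta_hat finset.set0) (beta_hat j)| <=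
    `|corr (Pr M) (Theta_hat finset.set0) (beta_hat l)|.

End Model.
Arguments W {R n p X} M w.

Inductive selection_rule (R : realType) :=
  | MinAIC of penalty
  | MinC
  | MinB
  | Pretest of R.
Arguments MinC {R}.
Arguments MinB {R}.

Definition valid_rule (R : realType) (r : selection_rule R) : Prop :=
  if r is Pretest d then 0 < d else True.

Definition cutoff (R : realType) (n p : nat) (r : selection_rule R) : R :=
  match r with
  | MinAIC pen =>
      Num.sqrt ((expR (2 * penalty_factor R pen n / n%:R) - 1) * (n - p)%:R)
  | MinC => Num.sqrt 2
  | MinB => 1
  | Pretest d => d
  end.

Definition candidates (p : nat) (l : 'I_p) : {set {set 'I_p}} :=
  [set [set l]; finset.set0]%SET.

Definition chosen_by (R : realType) (n p : nat) (X : 'M[R]_(n, p))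
    (M : gauss_model X) (l : 'I_p) (r : selection_rule R)
    (Kstar : Omega M -> {set 'I_p}) : Prop :=
  match r with
  | MinAIC pen =>
      forall w, minimizes (candidates l) (AIC_crit X pen (Y w)) (Kstar w)
  | MinC => forall w, minimizes (candidates l) (C_crit X (Y w)) (Kstar w)
  | MinB => forall w, minimizes (candidates l) (B_crit X (Y w)) (Kstar w)
  | Pretest d =>
      forall w, Kstar w =
        if d <= `|T_stat l w| then finset.set0 else [set l]%SET
  end.

(* Minimizers need not be unique on the null event of a tie, so Kstar is an
   arbitrary measurable selection. *)
Definition selects (R : realType) (n p : nat) (X : 'M[R]_(n, p))
    (M : gauss_model X) (l : 'I_p) (r : selection_rule R)
    (Kstar : Omega M -> {set 'I_p}) : Prop :=
  (forall K, measurable [set w | Kstar w = K]) /\ chosen_by l r Kstar.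

Section Formula.
Context (R : realType) (n p : nat) (t : nat -> R).

Definition ell1 (w : R) : R := - (t (n - p)%N * w).
Definition u1 (w : R) : R := t (n - p)%N * w.

Definition halfwidth2 (h w rho : R) : R :=
  t (n - p + 1)%N *
  Num.sqrt (((n - p)%:R * w ^+ 2 + h ^+ 2) / (n - p + 1)%:R) *
  Num.sqrt (1 - rho ^+ 2).

Definition ell2 (h w rho : R) : R := rho * h - halfwidth2 h w rho.
Definition u2 (h w rho : R) : R := rho * h + halfwidth2 h w rho.

Definition k_dagger (h w gamma rho : R) : R :=
  Psi (ell1 w) (u1 w) (rho * (h - gamma)) (1 - rho ^+ 2).

Definition k (h w gamma rho : R) : R :=
  Psi (ell2 h w rho) (u2 h w rho) (rho * (h - gamma)) (1 - rho ^+ 2).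

Definition coverage_formula (alpha d : R) (fW : R -> R) (gamma rho : R) : \bar R :=
  ((1 - alpha)%:E +
   \int[lebesgue_measure]_(w in `[0%R, +oo[)
     \int[lebesgue_measure]_(x in `[(- d)%R, d])
       ((k (w * x) w gamma rho - k_dagger (w * x) w gamma rho) *
        normal_pdf 0 1 (w * x - gamma) * w * fW w)%:E)%E.

End Formula.

(* Main.v *)
(** Plane rotations preserve the product of two standard normal laws, hence map
    families of independent standard normals to such families.  Composing them
    as in the QR factorization turns the errors into independent standard
    normals [z_i] such that [beta_hat_p] depends only on [z_l] ([l] the last
    index), [Theta_hat] only on [z_l] and one further coordinate [z_o], and
    [RSS / sigma ^ 2] is the sum of the remaining squares, a chi-squared
    variable.  With [H = z_l + gamma], each selection rule amounts, outside a
    null set, to choosing [{p}] iff [|H| <= d W].  The coverage event is thus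
    explicit in [(W, z_l, z_o)]: it is [|G| <= t W] off [|H| <= d W], where
    [G = (Theta_hat - theta) / (sigma sqrt v11)], and a different event on it.
    Since [|G| <= t W] has probability [1 - alpha], only the difference on
    [|H| <= d W] remains; conditioning on [W] and [H] and substituting [h = w x]
    gives the double integral.  Evenness in [gamma] is the symmetry
    [(z_l, z_o) -> (- z_l, - z_o)], evenness in [rho] is the reflection of a
    normal law. *)

Require Import Defs.
From mathcomp Require Import all_boot all_order all_algebra.
From mathcomp Require Import all_classical all_reals all_analysis.
From mathcomp Require Import measurable_realfun.
From mathcomp Require Import ring lra.

Set Implicit Arguments.
Unset Strict Implicit.
Unset Printing Implicit Defensive.

Import Order.TTheory GRing.Theory Num.Theory.
Import numFieldNormedType.Exports.

Local Open Scope classical_set_scope.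
Local Open Scope ring_scope.

(** * The standard normal law *)

(** Plane rotations suffice and reduce every change of variables to one-dimensional substitutions
    and Fubini. Independence is stated on boxes, which rotations do not preserve; uniqueness of
    measures on a product, applied to restrictions of the probability, extends it to tilted events.
    The triangular factor of [X] ends in the row [r * e_l], so imposing [beta_l = 0] means imposing
    that one rotated coordinate vanishes. Hence, with [m = n - p], [RSS = sigma^2 m W^2] becomes
    [sigma^2 (m W^2 + H^2)] under the restriction, and each criterion compares [H^2] with a fixed
    multiple of [W^2]: that multiple is [d^2]. The constants [r], [c0], [c1] of the canonical form
    depend on [X] and [a] alone, and [rho = c1 / sqrt (c0^2 + c1^2)]. The coverage is therefore one
    function of [gamma] for all models, which is what gives its evenness a meaning. Two degeneracies
    remain: [c0 = 0], that is [|rho| = 1], where the conditional law is a point mass, and [RSS = 0],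
    where quotients and logarithms take default values. Writing [N(mu, v)] as the law of
    [mu + sqrt v * Z] absorbs the first; the second is a null event. *)

Section density.
Local Open Scope ereal_scope.
Context d (T : measurableType d) (R : realType).
Variables (mu nu : {measure set T -> \bar R}) (g : T -> R).
Hypotheses (g0 : forall x, (0 <= g x)%R) (mg : measurable_fun setT g)
  (nuE : forall A, measurable A -> nu A = \int[mu]_(x in A) (g x)%:E).

Import HBNNSimple.

(** Both sides are limits of integrals of the same increasing simple functions, which reduces the
    claim to level sets, where it is [nuE]. It serves for the normal density and for the density of
    [W]. *)
Lemma ge0_integral_density (D : set T) (f : T -> \bar R) : measurable D ->
  measurable_fun D f -> (forall x, D x -> 0 <= f x) ->
  \int[nu]_(x in D) f x = \int[mu]_(x in D) (f x * (g x)%:E).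
Proof.
move=> mD mf f0.
pose h := nnsfun_approx mD mf.
have mg' (D' : set T) : measurable_fun D' (EFin \o g).
  by apply: measurable_funTS; exact/measurable_EFinP.
have -> : \int[nu]_(x in D) f x = limn (fun n => \int[nu]_(x in D) (h n x)%:E).
  rewrite -monotone_convergence//.
  - by apply: eq_integral => x /set_mem Dx; apply/esym/cvg_lim => //; exact: cvg_nnsfun_approx.
  - by move=> n; exact/measurable_EFinP/measurable_funTS.
  - by move=> n x _; rewrite lee_fin.
  - by move=> x _ a b ab; rewrite lee_fin; exact/lefP/nd_nnsfun_approx.
have -> : \int[mu]_(x in D) (f x * (g x)%:E) =
    limn (fun n => \int[mu]_(x in D) ((h n x)%:E * (g x)%:E)).
  rewrite -monotone_convergence//.
  - apply: eq_integral => x /set_mem Dx; apply/esym/cvg_lim => //.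
    by apply: cvgeZr => //; exact: cvg_nnsfun_approx.
  - move=> n; apply: emeasurable_funM; last exact: mg'.
    exact/measurable_EFinP/measurable_funTS.
  - by move=> n x _; rewrite mule_ge0// lee_fin.
  - move=> x _ a b ab; rewrite lee_wpmul2r// lee_fin//; exact/lefP/nd_nnsfun_approx.
congr (lim (_ @ \oo)); apply/funext => n.
under eq_integral do rewrite fimfunE -fsumEFin//.
have mind r : measurable_fun D (fun x => (r * \1_(h n @^-1` [set r]) x)%:E).
  by apply/measurable_EFinP/measurable_funTS/measurable_funM.
rewrite ge0_integral_fsum//; last first.
  by move=> r x _; rewrite nnfun_muleindic_ge0.
transitivity (\int[mu]_(x in D) (\sum_(r \in range (h n))
    ((r * \1_(h n @^-1` [set r]) x)%:E * (g x)%:E))); last first.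
  apply: eq_integral => x _; rewrite [in RHS]fimfunE -fsumEFin// ge0_mule_fsuml//.
  by move=> r; rewrite nnfun_muleindic_ge0.
rewrite ge0_integral_fsum//; last first.
  move=> r x _; rewrite mule_ge0//; last by rewrite lee_fin.
  by rewrite EFinM nnfun_muleindic_ge0.
  by move=> r; apply: emeasurable_funM => //; exact: mg'.
apply: eq_fsbigr => r _.
have mhr : measurable (h n @^-1` [set r]) by exact: measurable_sfunP.
rewrite integralZl_indic_nnsfun//.
(* A negative [r] has an empty level set; for the others the sign allows [r] to leave the
   integral. *)
have [r0|r0] := ltP r 0%R.
  by rewrite preimage_nnfun0// integral_indic// set0I measure0 mule0 integral0_eq// => x _;
  rewrite indic0 mulr0 mul0e.
under [RHS]eq_integral do rewrite EFinM -muleA.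
rewrite ge0_integralZl_EFin//; last 2 first.
- by move=> x _; rewrite mule_ge0// lee_fin.
- apply: emeasurable_funM; last exact: mg'.
  exact/measurable_EFinP/measurable_funTS.
congr (_ * _); rewrite integral_indic// nuE//; last exact: measurableI.
rewrite setIC integral_mkcondr.
by apply: eq_integral => x _; rewrite muleC epatch_indic.
Qed.
End density.

Section affine.
Context {R : realType}.
Notation mu := (@lebesgue_measure R).

Lemma measurable_affine (c b : R) :
  measurable_fun [set: measurableTypeR R] ((fun x => c * x + b) : _ -> measurableTypeR R).
Proof. by apply: measurable_funD => //; exact: measurable_funM. Qed.

(** The right-hand side, as a function of [A], is a scaled pushforward measure that gives every []u,
    v]] its length, and this characterizes Lebesgue measure. *)
Lemma lebesgue_measure_affine (c b : R) (A : set R) : 0 < c -> measurable A ->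
  mu A = (c%:E * mu ((fun x => (c * x + b)%R) @^-1` A))%E.
Proof.
move=> c0 mA.
pose c' := NngNum (ltW c0).
pose nu := mscale c' (pushforward mu ((fun x => (c * x + b)%R) : _ -> measurableTypeR R)).
suff -> : mu A = nu (measurable_affine c b) A by [].
rewrite /nu; apply: lebesgue_measure_unique => //.
move=> _ [[u v] _ <-] /=.
rewrite /mscale /= /pushforward.
rewrite (_ : _ @^-1` _ = `](u - b) / c, (v - b) / c]%classic); last first.
  apply/seteqP; split => x /=; rewrite !in_itv/= ltr_pdivrMr// ler_pdivlMr//.
    by rewrite ltrBlDr lerBrDr mulrC.
  by rewrite ltrBlDr lerBrDr mulrC.

have [uv|vu] := ltP u v; last first.
  rewrite !set_itv_ge ?measure0 ?mule0//= bnd_simp -leNgt//.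
  by rewrite ler_pM2r ?invr_gt0// lerD2r.
rewrite !lebesgue_measure_itv/= !lte_fin ltr_pM2r ?invr_gt0// ltrD2r uv.
by rewrite -!EFinD -EFinM; congr EFin; field; rewrite gt_eqF.
Qed.

Lemma ge0_integral_affine (c b : R) (f : R -> \bar R) : 0 < c ->
  measurable_fun setT f -> (forall x, 0 <= f x)%E ->
  (\int[mu]_x f x = c%:E * \int[mu]_x f (c * x + b)%R)%E.
Proof.
move=> c0 mf f0.
pose nu := mscale (NngNum (ltW c0))
  (pushforward mu ((fun x => (c * x + b)%R) : _ -> measurableTypeR R)).
rewrite (@eq_measure_integral _ _ _ _ (nu (measurable_affine c b))); last first.
  by move=> A mA _; exact: lebesgue_measure_affine.
rewrite ge0_integral_mscale//= ge0_integral_pushforward//.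
exact: measurable_affine.
Qed.
End affine.

Section std_normal.
Context {R : realType}.
Notation mu := (@lebesgue_measure R).
Notation phi := (normal_pdf (0 : R) 1).
Notation N01 := (normal_prob (0 : R) 1).

Lemma ge0_integral_normal (D : set R) (f : R -> \bar R) : measurable D ->
  measurable_fun D f -> (forall x, D x -> 0 <= f x)%E ->
  (\int[N01]_(x in D) f x = \int[mu]_(x in D) (f x * (phi x)%:E))%E.
Proof.
move=> mD mf f0; apply: (@ge0_integral_density _ (measurableTypeR R) R _ _ phi) => //.
- exact: normal_pdf_ge0.
- exact: measurable_normal_pdf.
Qed.

Lemma std_pdfE (x : R) : phi x = normal_peak 1 * expR (- (x ^+ 2 / 2)).
Proof.
by rewrite normal_pdfE ?oner_eq0// /normal_fun subr0 expr1n mulNr.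
Qed.

Lemma normal_prob_affine (m s : R) (A : set R) : 0 < s -> measurable A ->
  normal_prob m s A = N01 [set z | A (s * z + m)].
Proof.
move=> s0 mA; rewrite /normal_prob integral_mkcond.
rewrite (ge0_integral_affine m s0); last 2 first.
- apply/(measurable_restrictT _ _).1 => //; apply/measurable_funTS/measurable_EFinP.
  exact: measurable_normal_pdf.
- by move=> x; rewrite patchE; case: ifP => // _; rewrite lee_fin normal_pdf_ge0.
rewrite -ge0_integralZl_EFin ?ltW//; last 2 first.
- by move=> x _; rewrite patchE; case: ifP => // _; rewrite lee_fin normal_pdf_ge0.
- apply: (measurableT_comp (f := ((fun x => (normal_pdf m s x)%:E) \_ A))).
    apply/(measurable_restrictT _ _).1 => //; apply/measurable_funTS/measurable_EFinP.
    exact: measurable_normal_pdf.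
  exact: measurable_affine.
rewrite [RHS]integral_mkcond; apply: eq_integral => x _; rewrite !patchE.
rewrite (_ : (x \in [set z | A (s * z + m)]) = (s * x + m \in A)); last first.
  by apply/idP/idP; rewrite !inE.
case: ifP => _; rewrite ?mule0// -EFinM; congr EFin.
rewrite std_pdfE normal_pdfE ?gt_eqF// /normal_fun addrK.
rewrite mulrA /normal_peak expr1n mul1r; congr (_ * _).
  rewrite -mulrnAr sqrtrM ?sqr_ge0// sqrtr_sqr gtr0_norm// invfM mulrA divff ?mul1r//.
  by rewrite gt_eqF.
congr expR; field; by rewrite gt_eqF.
Qed.

Definition shear1 (a : R) (z : R * R) : R * R := (z.1 + a * z.2, z.2).
Definition shear2 (a : R) (z : R * R) : R * R := (z.1, z.2 + a * z.1).
Definition rot (c s : R) (z : R * R) : R * R :=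
  (c * z.1 - s * z.2, s * z.1 + c * z.2).

Local Notation T2 := (measurableTypeR R * measurableTypeR R)%type.

Lemma measurable_shear1 a : measurable_fun [set: T2] (shear1 a : T2 -> T2).
Proof.
apply: measurable_fun_pair => //=; apply: measurable_funD => //.
exact: measurable_funM.
Qed.

Lemma measurable_shear2 a : measurable_fun [set: T2] (shear2 a : T2 -> T2).
Proof.
apply: measurable_fun_pair => //=; apply: measurable_funD => //.
exact: measurable_funM.
Qed.

Lemma measurable_rot c s : measurable_fun [set: T2] (rot c s : T2 -> T2).
Proof.
apply: measurable_fun_pair => /=.
  by apply: measurable_funB => //; exact: measurable_funM.
by apply: measurable_funD => //; exact: measurable_funM.
Qed.

Lemma ge0_integral_shear1 a (f : T2 -> \bar R) : measurable_fun setT f ->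
  (forall x, 0 <= f x)%E ->
  (\int[mu \x mu]_z f z = \int[mu \x mu]_z f (shear1 a z))%E.
Proof.
move=> mf f0.
have mfs : measurable_fun setT (f \o shear1 a).
  by apply: measurableT_comp => //; exact: measurable_shear1.
rewrite fubini_tonelli2// [RHS]fubini_tonelli2//.
apply: eq_integral => y _; rewrite /fubini_G /=.
rewrite (ge0_integral_affine (a * y) (@ltr01 R))//.
  by rewrite mul1e; under eq_integral do rewrite mul1r.
exact: (@measurable_fun_pair1 _ _ _ (measurableTypeR R) (measurableTypeR R)).
Qed.

Lemma ge0_integral_shear2 a (f : T2 -> \bar R) : measurable_fun setT f ->
  (forall x, 0 <= f x)%E ->
  (\int[mu \x mu]_z f z = \int[mu \x mu]_z f (shear2 a z))%E.
Proof.
move=> mf f0.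
have mfs : measurable_fun setT (f \o shear2 a).
  by apply: measurableT_comp => //; exact: measurable_shear2.
rewrite fubini_tonelli1// [RHS]fubini_tonelli1//.
apply: eq_integral => y _; rewrite /fubini_F /=.
rewrite (ge0_integral_affine (a * y) (@ltr01 R))//.
  by rewrite mul1e; under eq_integral do rewrite mul1r.
exact: (@measurable_fun_pair2 _ _ _ (measurableTypeR R) (measurableTypeR R)).
Qed.

(* A rotation by an angle that is not a multiple of pi is a product of three
   shears, and each shear preserves Lebesgue measure by Fubini. *)
Lemma ge0_integral_rot c s (f : T2 -> \bar R) : s != 0 -> c ^+ 2 + s ^+ 2 = 1 ->
  measurable_fun setT f -> (forall x, 0 <= f x)%E ->
  (\int[mu \x mu]_z f z = \int[mu \x mu]_z f (rot c s z))%E.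
Proof.
(* For the angle [x] with cosine [c] and sine [s], [a] is [- tan (x / 2)]; the two identities below
   are half-angle formulas, and they are all that the factorization uses. *)
move=> s0 cs1 mf f0; pose a := (c - 1) / s.
have rotE z : rot c s z = shear1 a (shear2 s (shear1 a z)).
  have sE : s * a = c - 1 by rewrite mulrCA divff ?mulr1.
  have aE : a * (c + 1) = - s.
    by apply: (mulfI s0); rewrite mulrA sE; lra.
  clearbody a; case: z => x y; rewrite /rot /shear1 /shear2 /=; congr pair.
    transitivity (c * x + (a * (c + 1)) * y); first by rewrite aE; ring.
    transitivity (x + a * y + a * y + (s * a) * x + (s * a) * (a * y)); last by ring.
    by rewrite sE; ring.
  transitivity (y + s * x + (s * a) * y); last by ring.
  by rewrite sE; ring.
have m1 : measurable_fun setT (f \o shear1 a).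
  by apply: measurableT_comp => //; exact: measurable_shear1.
rewrite (ge0_integral_shear1 a)//.
rewrite (@ge0_integral_shear2 s (f \o shear1 a))//=.
rewrite (@ge0_integral_shear1 a (f \o shear1 a \o shear2 s))//=.
  by under [RHS]eq_integral do rewrite rotE.
by apply: measurableT_comp => //; exact: measurable_shear2.
Qed.

Definition phi2 (z : R * R) : R := phi z.1 * phi z.2.

Lemma measurable_phi2 : measurable_fun [set: T2] (phi2 : T2 -> measurableTypeR R).
Proof.
by apply: measurable_funM; apply: measurableT_comp => //;
  exact: measurable_normal_pdf.
Qed.

Lemma phi2_ge0 z : 0 <= phi2 z.
Proof. by rewrite mulr_ge0// normal_pdf_ge0. Qed.

Lemma phi2_rot c s z : c ^+ 2 + s ^+ 2 = 1 -> phi2 (rot c s z) = phi2 z.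
Proof.
move=> cs1; rewrite /phi2 !std_pdfE mulrACA [RHS]mulrACA; congr (_ * _).
rewrite -!expRD; congr expR; rewrite /rot /=.
transitivity (- ((c ^+ 2 + s ^+ 2) * (z.1 ^+ 2 + z.2 ^+ 2) / 2)); first by field.
by rewrite cs1; field.
Qed.

Lemma normal2E (E : set (R * R)) : measurable (E : set T2) ->
  ((N01 \x N01) E = \int[mu \x mu]_(z in E) (phi2 z)%:E)%E.
Proof.
move=> mE; rewrite integral_mkcond fubini_tonelli1//; last 2 first.
- apply/(measurable_restrictT _ _).1 => //; apply/measurable_funTS/measurable_EFinP.
  exact: measurable_phi2.
- by move=> z; rewrite patchE; case: ifP => // _; rewrite lee_fin phi2_ge0.
rewrite /product_measure1 ge0_integral_normal//; last exact: measurable_fun_xsection.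
apply: eq_integral => x _; rewrite /fubini_F /= /normal_prob.
rewrite -ge0_integralZr//; last 4 first.
- exact: measurable_xsection.
- by apply/measurable_funTS/measurable_EFinP; exact: measurable_normal_pdf.
- by move=> y _; rewrite lee_fin normal_pdf_ge0.
- by rewrite lee_fin normal_pdf_ge0.
rewrite integral_mkcond; apply: eq_integral => y _; rewrite !patchE.
rewrite mem_xsection; case: ifP => // _.
by rewrite /phi2 /= mulrC EFinM.
Qed.

(** Rotations preserve Lebesgue measure in the plane, and the joint density depends on the radius
    only. *)
Lemma normal2_rot c s (E : set (R * R)) : c ^+ 2 + s ^+ 2 = 1 ->
  measurable (E : set T2) -> ((N01 \x N01) (rot c s @^-1` E) = (N01 \x N01) E)%E.
Proof.
have mrot c' s' (F : set T2) : measurable F -> measurable (rot c' s' @^-1` F : set T2).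
  by move=> mF; rewrite -[_ @^-1` _]setTI; exact: measurable_rot.
have main c' s' (F : set (R * R)) : s' != 0 -> c' ^+ 2 + s' ^+ 2 = 1 ->
    measurable (F : set T2) -> ((N01 \x N01) (rot c' s' @^-1` F) = (N01 \x N01) F)%E.
  move=> s0 cs1 mF; rewrite !normal2E//; last exact: mrot.
  rewrite integral_mkcond [RHS]integral_mkcond [RHS](ge0_integral_rot s0 cs1)//; last 2 first.
  - apply/(measurable_restrictT _ _).1 => //; apply/measurable_funTS/measurable_EFinP.
    exact: measurable_phi2.
  - by move=> z; rewrite patchE; case: ifP => // _; rewrite lee_fin phi2_ge0.
  apply: eq_integral => z _; rewrite !patchE phi2_rot//.
move=> cs1 mE; have [s0|s0] := eqVneq s 0; last exact: main.
move: cs1; rewrite s0 expr0n addr0 => /eqP; rewrite sqrf_eq1 => /orP[|] /eqP ->.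
  by congr (product_measure1 _ _ _); apply/seteqP; split => -[x y]; rewrite /rot/= !mul1r !mul0r subr0 add0r.
(* The half-turn has [s = 0], where the shear factorization would divide by zero; it is the square
   of the quarter-turn. *)
have r01 : (0 : R) ^+ 2 + 1 ^+ 2 = 1 by rewrite expr0n expr1n add0r.
have rr z : rot (-1) 0 z = rot 0 1 (rot 0 1 z).
  by case: z => x y; rewrite /rot/=; congr pair; ring.
transitivity ((N01 \x N01) (rot 0 1 @^-1` (rot 0 1 @^-1` E)))%E.
  by congr (product_measure1 _ _ _); apply/seteqP; split => z /=; rewrite rr.
by rewrite !main// ?oner_neq0//; exact: mrot.
Qed.

End std_normal.

Section measurable_sets.
Context d (T : measurableType d) (R : realType).
Implicit Types f g : T -> measurableTypeR R.

Lemma measurable_preimageT d' (T' : measurableType d') (f : T -> T') (A : set T') :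
  measurable_fun setT f -> measurable A -> measurable (f @^-1` A).
Proof. by move=> mf mA; rewrite -[X in measurable X]setTI; exact: mf. Qed.

Lemma measurable_leset f g : measurable_fun setT f -> measurable_fun setT g ->
  measurable [set z | f z <= g z].
Proof.
move=> mf mg.
have -> : [set z | f z <= g z] = (fun z => g z - f z) @^-1` `[0, +oo[.
  by apply/seteqP; split => z; rewrite /= in_itv/= andbT subr_ge0.
by apply: measurable_preimageT => //; exact: measurable_funB.
Qed.

Lemma measurable_eqset f g : measurable_fun setT f -> measurable_fun setT g ->
  measurable [set z | f z = g z].
Proof.
move=> mf mg.
have -> : [set z | f z = g z] = [set z | f z <= g z] `&` [set z | g z <= f z].
  apply/seteqP; split => z /=; first by move=> ->.
  by move=> [h1 h2]; apply/eqP; rewrite eq_le h1.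
by apply: measurableI; exact: measurable_leset.
Qed.

End measurable_sets.

Section std_normal2.
Context {R : realType}.
Notation mu := (@lebesgue_measure R).
Notation phi := (normal_pdf (0 : R) 1).
Notation N01 := (normal_prob (0 : R) 1).
Local Notation T2 := (measurableTypeR R * measurableTypeR R)%type.

(** The half-turn of the plane acts on the strip over [A] as the reflection of [A]. *)
Lemma std_normalN (A : set R) : measurable A -> N01 [set z | A (- z)] = N01 A.
Proof.
move=> mA.
have mA' : measurable [set z : measurableTypeR R | A (- z)].
  rewrite -[X in measurable X]setTI; exact: measurable_funN.
have cs1 : (-1) ^+ 2 + 0 ^+ 2 = 1 :> R by rewrite sqrrN expr1n expr0n addr0.
have mAT : measurable (A `*` setT : set T2) by exact: measurableX.
have := normal2_rot cs1 mAT.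
have -> : rot (-1) 0 @^-1` (A `*` setT) = [set z | A (- z)] `*` [set: R].
  by apply/seteqP; split => -[x y] /=; rewrite mul0r subr0 mulN1r.
have prodT (B : set (measurableTypeR R)) : measurable B ->
    (N01 \x N01)%E (B `*` [set: R]) = N01 B.
  move=> mB; rewrite product_measure1E//=.
  by rewrite [X in (_ * X)%E](_ : _ = 1%E) ?mule1//; exact: probability_setT.
by rewrite !prodT.
Qed.

(** The form [m + sqrt v * Z] covers the point mass [v = 0] as well, so that no later argument has
    to distinguish [|rho| = 1]. *)
Lemma PsiE (x y m v : R) : 0 <= v ->
  (Psi x y m v)%:E = N01 [set z | x <= m + Num.sqrt v * z <= y].
Proof.
move=> v0; rewrite /Psi /normal_law.
have mE : measurable `[x, y]%classic by [].
case: eqP => [->|/eqP vN0].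
  rewrite diracE sqrtr0.
  rewrite (_ : [set z | x <= m + 0 * z <= y] = if x <= m <= y then setT else set0); last first.
    by apply/seteqP; split => z /=; rewrite mul0r addr0; case: ifP.
  rewrite mem_setE in_itv /=.
  by case: ifP => _; [exact/esym/probability_setT|rewrite measure0].
have sv : 0 < Num.sqrt v by rewrite sqrtr_gt0 lt_neqAle eq_sym vN0.
rewrite fineK; last exact: fin_num_measure.
rewrite normal_prob_affine//; congr (normal_prob _ _ _).
by apply/seteqP; split => z /=; rewrite in_itv/= addrC.
Qed.

Lemma PsiN (x y m v : R) : 0 <= v -> Psi (- y) (- x) (- m) v = Psi x y m v.
Proof.
move=> v0; apply: EFin_inj; rewrite !PsiE//.
rewrite -[RHS]std_normalN; last first.
  rewrite [X in measurable X](_ : _ =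
      (fun z => Num.sqrt v * z + m) @^-1` `[x, y]); last first.
    by apply/seteqP; split => z; rewrite /= in_itv/= addrC.
  rewrite -[X in measurable X]setTI; exact: measurable_affine.
congr (normal_prob _ _ _); apply/seteqP; split => z /=;
by move=> /andP[h1 h2]; apply/andP; split; lra.
Qed.

Lemma is_derive_std_pdf (x : R) :
  is_derive x (1 : R^o) (fun x => - phi x : R^o) (x * phi x).
Proof.
have -> : (fun x => - phi x) = (fun x => - (normal_peak 1 * expR (- (x ^+ 2 / 2)))).
  by apply/funext => y; rewrite std_pdfE.
rewrite std_pdfE.
apply: is_derive_eq.
by rewrite /GRing.scale /= mulr1; field.
Qed.

Lemma cvg_std_pdfy : phi x @[x --> +oo%R] --> (0 : R).
Proof.
rewrite (_ : normal_pdf 0 1 = fun x => normal_peak 1 * expR (- (x ^+ 2 / 2))); last first.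
  by apply/funext => y; rewrite std_pdfE.
rewrite -(mulr0 (normal_peak 1)); apply: cvgM; first exact: cvg_cst.
apply: (cvg_comp (fun x => x ^+ 2 / 2) (fun x => expR (- x))); last exact: cvgr_expR.
by apply: gt0_cvgMly; [rewrite invr_gt0|exact: cvgr_expr2].
Qed.

(** The antiderivative of [x * phi x] is [- phi x], which vanishes at infinity. *)
Lemma integral_id_std_pdf (y : R) : 0 <= y ->
  (\int[mu]_(x in `[y, +oo[) (x * phi x)%:E = (phi y)%:E)%E.
Proof.
move=> y0.
have cphi : continuous phi by apply: continuous_normal_pdf; exact: oner_neq0.
rewrite (@ge0_continuous_FTC2y _ _ (fun x => - phi x) _ 0)//.
- by rewrite sub0e EFinN oppeK.
- by move=> x yx; rewrite mulr_ge0 ?normal_pdf_ge0// (le_trans y0).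
- apply: continuous_subspaceT => x; apply: cvgM; [exact: cvg_id|exact: cphi].
- by have := @cvgN _ _ _ _ _ _ _ cvg_std_pdfy; rewrite oppr0; exact.
- by move=> x _; exact: (@ex_derive _ _ _ _ _ _ _ (is_derive_std_pdf x)).
- by apply: cvgN; apply/cvg_at_right_filter; exact: cphi.
- by move=> x _; rewrite derive1E; exact: (@derive_val _ _ _ _ _ _ _ (is_derive_std_pdf x)).
Qed.

Lemma std_pdfN (x : R) : phi (- x) = phi x.
Proof. by rewrite !std_pdfE sqrrN. Qed.

(* Tonelli for [y * phi y] on [0 <= x <= y], with [phi x] the integral of
   [y * phi y] over [y >= x]. *)
Lemma integral_sqr_half :
  (\int[mu]_(x in `[0%R, +oo[) (x ^+ 2 * phi x)%:E =
   \int[mu]_(x in `[0%R, +oo[) (phi x)%:E)%E.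
Proof.
pose D := [set z : T2 | 0 <= z.1 <= z.2].
have mD : measurable D.
  rewrite (_ : D = [set z : T2 | 0 <= z.1] `&` [set z : T2 | z.1 <= z.2]); last first.
    by apply/seteqP; split => z /= /andP.
  by apply: measurableI; exact: measurable_leset.
pose f (z : T2) := (((fun z : T2 => (z.2 * phi z.2)%:E) \_ D) z)%E.
have mf : measurable_fun setT f.
  apply/(measurable_restrictT _ _).1 => //; apply/measurable_funTS/measurable_EFinP.
  apply: measurable_funM => //; apply: measurableT_comp => //.
  exact: measurable_normal_pdf.
have f0 z : (0 <= f z)%E.
  rewrite /f patchE; case: ifPn => //; rewrite inE => -[/= /andP[z1 z2]].
  by rewrite lee_fin mulr_ge0 ?normal_pdf_ge0// (le_trans z1).
have fE x y : f (x, y) = if 0 <= x <= y then (y * phi y)%:E else 0%E.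
  rewrite /f patchE (_ : (_ \in D) = (0 <= x <= y))//.
  by apply/idP/idP; rewrite inE.
have := fubini_tonelli (m1 := mu) (m2 := mu) f mf f0.
rewrite [X in X = _ -> _](_ : _ = \int[mu]_(x in `[0%R, +oo[) (phi x)%:E)%E; last first.
  rewrite [RHS]integral_mkcond; apply: eq_integral => x _; rewrite patchE.
  rewrite mem_setE in_itv/= andbT; case: ifP => x0.
    rewrite -integral_id_std_pdf// [RHS]integral_mkcond; apply: eq_integral => y _.
    by rewrite fE x0 patchE mem_setE in_itv/= andbT.
  by apply: integral0_eq => y _; rewrite fE x0.
move=> ->; rewrite integral_mkcond; apply: eq_integral => y _.
rewrite patchE mem_setE in_itv/= andbT; case: ifP => y0.
  transitivity (\int[mu]_(x in `[0%R, y]) (y * phi y)%:E)%E.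
    rewrite integral_cst// [X in (_ * X)%E]lebesgue_measure_itv/= lte_fin.
    have [y1|y1] := ltP 0 y.
      by rewrite sube0 -EFinM; congr EFin; ring.
    have -> : y = 0 by apply/eqP; rewrite eq_le y0 y1.
    by rewrite mul0r mule0 expr0n/= mul0r.
  rewrite integral_mkcond; apply: eq_integral => x _.
  by rewrite fE patchE mem_setE in_itv.
apply/esym/integral0_eq => x _; rewrite fE.
by case: ifP => // /andP[x0 xy]; rewrite (le_trans x0 xy) in y0.
Qed.

(** By evenness the second moment and the total mass are both twice their half-line parts, which
    agree by [integral_sqr_half]. The unit variance is needed because [v11], [v12], [v22] and [vK]
    are defined through covariances. *)
Lemma integral_sqr_normal : (\int[N01]_x (x ^+ 2)%:E = 1)%E.
Proof.
have cphi : continuous phi by apply: continuous_normal_pdf; exact: oner_neq0.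
have halfE : [set x : R | 0 <= x] = `[0, +oo[%classic.
  by apply/seteqP; split => x/=; rewrite in_itv/= andbT.
rewrite ge0_integral_normal//; last 2 first.
- by apply/measurable_EFinP; exact: measurable_funX.
- by move=> x _; rewrite lee_fin sqr_ge0.
rewrite [LHS](_ : _ = \int[mu]_x (x ^+ 2 * phi x)%:E)%E; last first.
  by under eq_integral do rewrite -EFinM.
rewrite ge0_symfun_integralT; last 3 first.
- by move=> x; rewrite mulr_ge0 ?normal_pdf_ge0 ?sqr_ge0.
- by move=> x; apply: cvgM; [exact: exprn_continuous|exact: cphi].
- by move=> x /=; rewrite std_pdfN sqrrN.
rewrite halfE integral_sqr_half -halfE -ge0_symfun_integralT//.
- exact: integral_normal_pdf.
- exact: normal_pdf_ge0.
- by move=> x /=; rewrite std_pdfN.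
Qed.

End std_normal2.

(** * Independent standard normal families *)

Section product_unique.
Local Open Scope ereal_scope.
Context d1 d2 (T1 : measurableType d1) (T2 : measurableType d2) (R : realType).
Variables (P1 : probability T1 R) (P2 : probability T2 R).

(** The factor [c] lets [m] be the joint law of two variables under [P] restricted to an event of
    probability [c]; constraints on further independent variables are carried along in this way. *)
Lemma product_prob_unique (c : \bar R) (m : {measure set (T1 * T2) -> \bar R}) :
  0 <= c -> c < +oo ->
  (forall A B, measurable A -> measurable B -> m (A `*` B) = c * (P1 A * P2 B)) ->
  forall X : set (T1 * T2), measurable X -> m X = c * (P1 \x P2) X.
Proof.
move=> c0 coo mE X mX.
have cfin : c \is a fin_num by rewrite ge0_fin_numE.
pose c' : {nonneg R} := NngNum (fine_ge0 c0).
have cE : c = c'%:num%:E by rewrite /= fineK.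
suff : m X = mscale c' (P1 \x P2) X by rewrite cE.
pose C : set (set (T1 * T2)) :=
  [set C | exists A, measurable A /\ exists B, measurable B /\ C = A `*` B].
apply: (@measure_unique _ _ _ C (fun=> setT)) => //.
- rewrite measurable_prod_measurableType //; congr (<<s _ >>).
  rewrite predeqE; split => [[A mA [B mB <-]]|[A [mA [B [mB ->]]]]].
    by exists A; split => //; exists B.
  by exists A => //; exists B.
- move=> /= _ _ [X1 [mX1 [X2 [mX2 ->]]]] [Y1 [mY1 [Y2 [mY2 ->]]]].
  rewrite -setXI; exists (X1 `&` Y1); split; first exact: measurableI.
  by exists (X2 `&` Y2); split => //; exact: measurableI.
- move=> n; exists setT; split => //; exists setT; split => //.
  by rewrite setXTT.
- by rewrite bigcup_const.
- move=> A [A1 [mA1 [A2 [mA2 ->]]]]; rewrite mE//= /mscale/= -cE.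
  by rewrite product_measure1E.
- move=> k; rewrite -setXTT mE// !probability_setT mule1 mule1//.
Qed.
End product_unique.

Section iid.
Context {R : realType}.
Notation N01 := (normal_prob (0 : R) 1).
Local Notation RM := (measurableTypeR R).

(* The product rule over the full index set suffices: the other index sets
   follow by taking [A i = setT]. *)
Definition std_iid d (T : measurableType d) (P : probability T R) n
    (z : 'I_n -> T -> R) : Prop :=
  (forall i, measurable_fun setT (z i : T -> RM)) /\
  forall A : 'I_n -> set R, (forall i, measurable (A i : set RM)) ->
    P [set w | forall i, A i (z i w)] = (\prod_i N01 (A i))%E.

Lemma prod_prob_ge0 (I : finType) (D : pred I) (A : I -> set RM) :
  (0 <= \prod_(k | D k) N01 (A k))%E.
Proof. by apply: prode_ge0 => k _; exact: measure_ge0. Qed.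

Lemma prod_prob_lty (I : finType) (D : pred I) (A : I -> set RM) :
  (forall k, measurable (A k)) -> (\prod_(k | D k) N01 (A k) < +oo)%E.
Proof.
move=> mA; rewrite -ge0_fin_numE ?prod_prob_ge0//.
elim/big_ind : _ => // [x y xf yf|k _]; first by rewrite fin_numM.
exact: fin_num_measure.
Qed.

Section plane.
Context d (T : measurableType d) (P : probability T R) n (z : 'I_n -> T -> R).
Hypothesis iidz : std_iid P z.

Lemma measurable_forall_ord m (A : 'I_m -> set R) (y : 'I_m -> T -> R) (D : pred 'I_m) :
  (forall i, measurable (A i : set RM)) ->
  (forall i, measurable_fun setT (y i : T -> RM)) ->
  measurable [set w | forall i, D i -> A i (y i w)].
Proof.
move=> mA my.
rewrite (_ : [set w | _] = \bigcap_(i in [set i | D i]) (y i @^-1` A i)).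
  apply: fin_bigcap_measurable => //= i _.
  exact: (measurable_preimageT (my i) (mA i)).
by apply/seteqP; split => w /= h i; exact: h.
Qed.

(** The preimage of a box under a rotation of two coordinates is not a box, so the product rule is
    first extended to arbitrary planar events in these coordinates, the remaining ones staying in a
    box. *)
Lemma std_iid_plane (i j : 'I_n) (A : 'I_n -> set R) (E : set (R * R)) :
  i != j -> (forall k, measurable (A k : set RM)) -> measurable (E : set (RM * RM)) ->
  P [set w | E (z i w, z j w) /\ forall k, k != i -> k != j -> A k (z k w)] =
  ((\prod_(k | (k != i) && (k != j)) N01 (A k)) * (N01 \x N01) E)%E.
Proof.
move=> ij mA mE; have [mz zE] := iidz.
pose D := [set w | forall k, (k != i) && (k != j) -> A k (z k w)].
have mD : measurable D by exact: measurable_forall_ord.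
have mzz : measurable_fun setT (fun w => (z i w, z j w) : RM * RM).
  exact: measurable_fun_pair.
pose m := pushforward (mrestr P mD) (fun w => (z i w, z j w) : RM * RM).
transitivity (m E).
  rewrite /m /pushforward /mrestr /=; congr (P _).
  apply/seteqP; split => w /=.
    by move=> [h1 h2]; split => // k /andP[]; exact: h2.
  by move=> [h1 h2]; split => // k ki kj; apply: h2; rewrite ki.
rewrite /m; apply: product_prob_unique => //.
- exact: prod_prob_ge0.
- exact: prod_prob_lty.
move=> B1 B2 mB1 mB2 /=.
pose A' k := if k == i then B1 else if k == j then B2 else A k.
have mA' k : measurable (A' k : set RM) by rewrite /A'; case: ifP => // _; case: ifP.
transitivity (P [set w | forall k, A' k (z k w)]).
  rewrite /pushforward /mrestr /=; congr (P _); apply/seteqP; split => w /=.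
    move=> [[h1 h2] h3] k; rewrite /A'; case: eqVneq => [->//|ki].
    by case: eqVneq => [->//|kj]; apply: h3; rewrite ki.
  move=> h; split.
    have := h i; rewrite /A' eqxx => h1.
    by have := h j; rewrite /A' eqxx eq_sym (negbTE ij).
  by move=> k /andP[ki kj]; have := h k; rewrite /A' (negbTE ki) (negbTE kj).
rewrite zE// (bigD1 i)//= (bigD1 j)/=; last by rewrite eq_sym.
rewrite /A' eqxx eq_sym (negbTE ij) eqxx muleA [RHS]muleC; congr (_ * _)%E.
by apply: eq_bigr => k /andP[ki kj]; rewrite (negbTE ki) (negbTE kj).
Qed.

Lemma std_iid_plane_map (F : R * R -> R * R) (i j : 'I_n) :
  i != j -> measurable_fun setT (F : RM * RM -> RM * RM) ->
  (forall E, measurable (E : set (RM * RM)) ->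
    ((N01 \x N01) (F @^-1` E) = (N01 \x N01) E)%E) ->
  std_iid P (fun k w => if k == i then (F (z i w, z j w)).1
                        else if k == j then (F (z i w, z j w)).2 else z k w).
Proof.
move=> ij mF FE; have [mz zE] := iidz.
have mzz : measurable_fun setT (fun w => (z i w, z j w) : RM * RM).
  exact: measurable_fun_pair.
have mFz : measurable_fun setT (fun w => F (z i w, z j w) : RM * RM).
  exact: (measurableT_comp mF mzz).
split.
  move=> k; case: eqVneq => _; first exact: (measurableT_comp measurable_fst mFz).
  by case: eqVneq => _//; exact: (measurableT_comp measurable_snd mFz).
move=> A mA.
have mE : measurable (A i `*` A j : set (RM * RM)) by exact: measurableX.
transitivity (P [set w | (F @^-1` (A i `*` A j)) (z i w, z j w) /\
    forall k, k != i -> k != j -> A k (z k w)]).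
  congr (P _); apply/seteqP; split => w /=.
    move=> h; split; [split|].
    - by have := h i; rewrite eqxx.
    - by have := h j; rewrite eqxx eq_sym (negbTE ij).
    - by move=> k ki kj; have := h k; rewrite (negbTE ki) (negbTE kj).
  move=> [[h1 h2] h3] k; case: eqVneq => [->//|ki].
  by case: eqVneq => [->//|kj]; exact: h3.
rewrite std_iid_plane//; last exact: measurable_preimageT.
rewrite FE// product_measure1E//= [RHS](bigD1 i)//=.
rewrite [in RHS](bigD1 j)/=; last by rewrite eq_sym.
by rewrite muleC -muleA.
Qed.

Lemma std_iid_sign (e : 'I_n -> bool) :
  std_iid P (fun k w => if e k then - z k w else z k w).
Proof.
have [mz zE] := iidz; split.
  by move=> k; case: (e k) => //; exact: (measurable_funN (mz k)).
move=> A mA; pose A' k := if e k then [set x | A k (- x)] else A k.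
have mA' k : measurable (A' k : set RM).
  by rewrite /A'; case: (e k) => //; exact: (measurable_preimageT (f := -%R : RM -> RM)).
transitivity (P [set w | forall k, A' k (z k w)]).
  by congr (P _); apply/seteqP; split => w /= h k; have := h k; rewrite /A'; case: (e k).
rewrite zE//; apply: eq_bigr => k _; rewrite /A'; case: (e k) => //.
exact: std_normalN (mA k).
Qed.

End plane.

Lemma dotE n (x y : 'cV[R]_n) : dot x y = \sum_i x i 0 * y i 0.
Proof. by rewrite /dot mxE; apply: eq_bigr => i _; rewrite mxE. Qed.

(* Every orthogonal matrix satisfies this, but only plane rotations and sign
   changes, and their products, are needed. *)
Definition gauss_isometry n (U : 'M[R]_n) : Prop :=
  (forall x : 'cV[R]_n, dot (U *m x) (U *m x) = dot x x) /\
  forall d (T : measurableType d) (P : probability T R) (z : 'I_n -> T -> R),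
    std_iid P z -> std_iid P (fun i w => \sum_j U i j * z j w).

Lemma gauss_isometry1 n : gauss_isometry (1%:M : 'M[R]_n).
Proof.
split; first by move=> x; rewrite mul1mx.
move=> d T P z; congr (std_iid P _); apply/funext => i; apply/funext => w.
rewrite (bigD1 i)//= mxE eqxx mul1r big1 ?addr0// => j ji.
by rewrite mxE eq_sym (negbTE ji) mul0r.
Qed.

Lemma gauss_isometryM n (U V : 'M[R]_n) :
  gauss_isometry U -> gauss_isometry V -> gauss_isometry (U *m V).
Proof.
move=> [U1 U2] [V1 V2]; split; first by move=> x; rewrite -mulmxA U1.
move=> d T P z /V2/U2; congr (std_iid P _); apply/funext => i; apply/funext => w.
transitivity (\sum_j \sum_k U i j * (V j k * z k w)).
  by apply: eq_bigr => j _; rewrite mulr_sumr.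
rewrite exchange_big; apply: eq_bigr => k _.
by rewrite mxE mulr_suml; apply: eq_bigr => j _; rewrite mulrA.
Qed.

Definition sign_mx n (e : 'I_n -> bool) : 'M[R]_n :=
  diag_mx (\row_i (-1) ^+ e i).

Lemma sign_mxE n e (x : 'cV[R]_n) i : (sign_mx e *m x) i 0 = (-1) ^+ e i * x i 0.
Proof. by rewrite mul_diag_mx !mxE. Qed.

Lemma gauss_isometry_sign n (e : 'I_n -> bool) : gauss_isometry (sign_mx e).
Proof.
split.
  move=> x; rewrite !dotE; apply: eq_bigr => i _.
  by rewrite !sign_mxE; case: (e i); rewrite ?mul1r// mulN1r mulrNN.
move=> d T P z /std_iid_sign /(_ e); congr (std_iid P _).
apply/funext => i; apply/funext => w.
rewrite (bigD1 i)//= !mxE eqxx big1 ?addr0 => [|j ji]; last first.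
  by rewrite !mxE eq_sym (negbTE ji) mulr0n mul0r.
by rewrite mulr1n; case: (e i); rewrite ?mul1r// mulN1r.
Qed.

Definition givens n (i j : 'I_n) (c s : R) : 'M[R]_n :=
  \matrix_(k, m) if k == i then c *+ (m == i) - s *+ (m == j)
                 else if k == j then s *+ (m == i) + c *+ (m == j)
                 else (m == k)%:R.

Lemma sum_pick n (i : 'I_n) (a : R) (x : 'I_n -> R) :
  \sum_m a *+ (m == i) * x m = a * x i.
Proof.
rewrite (bigD1 i)//= eqxx mulr1n big1 ?addr0// => m /negbTE ->.
by rewrite mulr0n mul0r.
Qed.

Lemma sum_givens n (i j : 'I_n) c s (x : 'I_n -> R) k :
  \sum_m givens i j c s k m * x m =
    if k == i then c * x i - s * x j
    else if k == j then s * x i + c * x j else x k.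
Proof.
under eq_bigr do rewrite mxE.
case: ifP => _.
  under eq_bigr do rewrite mulrDl mulNr.
  by rewrite big_split/= sumrN !sum_pick.
case: ifP => _.
  under eq_bigr do rewrite mulrDl.
  by rewrite big_split/= !sum_pick.
by rewrite (sum_pick k 1) mul1r.
Qed.

Lemma mul_givens n (i j : 'I_n) c s (x : 'cV[R]_n) k :
  (givens i j c s *m x) k 0 =
    if k == i then c * x i 0 - s * x j 0
    else if k == j then s * x i 0 + c * x j 0 else x k 0.
Proof. by rewrite mxE (sum_givens i j c s (fun m => x m 0)). Qed.

Lemma gauss_isometry_givens n (i j : 'I_n) c s : i != j -> c ^+ 2 + s ^+ 2 = 1 ->
  gauss_isometry (givens i j c s).
Proof.
move=> ij cs1; split.
  move=> x; rewrite !dotE; under eq_bigr do rewrite !mul_givens.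
  have ji : j != i by rewrite eq_sym.
  rewrite (bigD1 i)//= (bigD1 j)//= eqxx (negbTE ji) eqxx.
  rewrite [RHS](bigD1 i)//= [in RHS](bigD1 j)//= !addrA; congr (_ + _).
    rewrite -[RHS]mul1r -cs1; ring.
  by apply: eq_bigr => k /andP[/negbTE -> /negbTE ->].
move=> d T P z /std_iid_plane_map /(_ (rot c s) i j ij (measurable_rot c s)).
move=> /(_ (fun E => @normal2_rot R c s E cs1)).
congr (std_iid P _); apply/funext => k; apply/funext => w.
by rewrite (sum_givens i j c s (fun m => z m w)).
Qed.

End iid.

(** * Canonical form of the design matrix *)

Section triangular.
Context {R : realType}.
Implicit Types n p : nat.

(** The last two clauses protect earlier work: a rotation in the plane of [i] and [j] leaves the
    other entries alone and fixes every vector vanishing at [i] and [j]. *)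
Lemma kill_entry n (i j : 'I_n) (v : 'cV[R]_n) : i != j ->
  exists U, [/\ gauss_isometry U, (U *m v) j 0 = 0,
    forall (x : 'cV[R]_n) k, k != i -> k != j -> (U *m x) k 0 = x k 0 &
    forall x : 'cV[R]_n, x i 0 = 0 -> x j 0 = 0 -> U *m x = x].
Proof.
move=> ij; set a := v i 0; set b := v j 0; pose r := Num.sqrt (a ^+ 2 + b ^+ 2).
have ab0 : 0 <= a ^+ 2 + b ^+ 2 by rewrite addr_ge0// sqr_ge0.
have [r0|rN0] := eqVneq r 0.
  exists 1%:M; split => [||x k _ _|x _ _]; rewrite ?mul1mx//.
    exact: gauss_isometry1.
  have /eqP : a ^+ 2 + b ^+ 2 = 0 by rewrite -[LHS]sqr_sqrtr// -/r r0 expr0n.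
  by rewrite paddr_eq0 ?sqr_ge0// !sqrf_eq0 => /andP[_ /eqP].
have r2 : r ^+ 2 = a ^+ 2 + b ^+ 2 by rewrite sqr_sqrtr.
(* This is the rotation taking [(a, b)] to [(r, 0)]. *)
exists (givens i j (a / r) (- b / r)); split.
- apply: gauss_isometry_givens => //.
  by rewrite !exprMn sqrrN -mulrDl -r2 -exprMn divff// expr1n.
- by rewrite mul_givens eq_sym (negbTE ij) eqxx -/a -/b; field.
- by move=> x k ki kj; rewrite mul_givens (negbTE ki) (negbTE kj).
- move=> x xi xj; apply/matrixP => k l; rewrite (ord1 l) mul_givens xi xj !mulr0 subrr addr0.
  by case: eqVneq => [->//|_]; case: eqVneq => [->|].
Qed.

(** The entries indexed by [s] are folded one by one into entry [i]; a later rotation acts on [i]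
    and a new index only, hence keeps the zeros already created. *)
Lemma kill_entries n (i : 'I_n) (s : seq 'I_n) (v : 'cV[R]_n) : i \notin s ->
  exists U, [/\ gauss_isometry U, forall k, k \in s -> (U *m v) k 0 = 0,
    forall (x : 'cV[R]_n) k, k \notin i :: s -> (U *m x) k 0 = x k 0 &
    forall x : 'cV[R]_n, (forall k, k \in i :: s -> x k 0 = 0) -> U *m x = x].
Proof.
elim: s => [_|j s IHs].
  exists 1%:M; split => [||x k _|x _]; rewrite ?mul1mx//; exact: gauss_isometry1.
rewrite inE negb_or => /andP[ij si]; have [U [gU Uv Uo Uf]] := IHs si.
have [V [gV Vv Vo Vf]] := kill_entry (U *m v) ij.
exists (V *m U); split; first exact: gauss_isometryM.
- move=> k; rewrite -mulmxA inE; case: eqVneq => [->//|kj /= ks].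
  by rewrite Vo ?Uv//; apply: contraNneq si => <-.
- move=> x k; rewrite !inE !negb_or -mulmxA => /and3P[ki kj ks].
  by rewrite Vo// Uo// inE negb_or ki.
- move=> x x0; rewrite -mulmxA Uf => [|k ks]; last first.
    by apply: x0; move: ks; rewrite !inE => /orP[->//|->]; rewrite !orbT.
  by apply: Vf; apply: x0; rewrite !inE eqxx ?orbT.
Qed.

(* QR factorization by plane rotations, one column at a time. *)
Lemma triangularize n p (X : 'M[R]_(n, p)) m : (p <= n)%N -> (m <= p)%N ->
  exists2 U : 'M[R]_n, gauss_isometry U &
    forall (i : 'I_n) (j : 'I_p), (j < m)%N -> (j < i)%N -> (U *m X) i j = 0.
Proof.
move=> pn; elim: m => [_|m IHm mp].
  by exists 1%:M => //; exact: gauss_isometry1.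
have [U gU UX] := IHm (ltnW mp).
pose i0 := Ordinal (leq_trans mp pn); pose j0 := Ordinal mp.
pose s := [seq i : 'I_n <- enum 'I_n | (m < i)%N].
have i0s : i0 \notin s by rewrite mem_filter ltnn.
have [V [gV Vv _ Vf]] := kill_entries (col j0 (U *m X)) i0s.
exists (V *m U); first exact: gauss_isometryM.
move=> i j jm ji.
have -> : (V *m U *m X) i j = (V *m col j (U *m X)) i 0.
  by rewrite -mulmxA !mxE; apply: eq_bigr => k _; rewrite [in RHS]mxE.
move: jm; rewrite ltnS leq_eqVlt => /orP[/eqP jm|jm].
  have -> : j = j0 by exact: val_inj.
  by apply: Vv; rewrite mem_filter mem_enum inE andbT -jm.
(* A column [j < m] already vanishes in row [m] and below, that is, in all rows that [V] may
   alter. *)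
rewrite Vf => [|k]; first by rewrite mxE UX.
rewrite inE mem_filter mem_enum andbT => kin.
rewrite mxE UX//; apply: (leq_trans jm).
by case/orP: kin => [/eqP ->//|/ltnW].
Qed.

Lemma col_mulmx m n p (A : 'M[R]_(m, n)) (B : 'M[R]_(n, p)) j :
  col j (A *m B) = A *m col j B.
Proof.
apply/matrixP => i k; rewrite [LHS]mxE [LHS]mxE [RHS]mxE.
by apply: eq_bigr => h _; rewrite [in RHS]mxE.
Qed.

Definition topmx n p (pn : (p <= n)%N) (Z : 'M[R]_(n, p)) : 'M[R]_p :=
  \matrix_(i, j) Z (widen_ord pn i) j.

Lemma sum_widen n p (pn : (p <= n)%N) (f : 'I_n -> R) :
  (forall i : 'I_n, (p <= i)%N -> f i = 0) ->
  \sum_i f i = \sum_(i < p) f (widen_ord pn i).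
Proof.
move=> f0; pose g k := if insub k is Some i then f i else 0.
have gE (i : 'I_n) : f i = g i by rewrite /g valK.
under eq_bigr do rewrite gE; under [RHS]eq_bigr do rewrite gE /=.
rewrite (big_ord_widen n g pn) [RHS]big_mkcond/=; apply: eq_bigr => i _.
by case: ltnP => // pi; rewrite -gE f0.
Qed.

(** Polarization of the norm identity in [gauss_isometry]. *)
Lemma gauss_isometry_dot n (U : 'M[R]_n) (x y : 'cV[R]_n) : gauss_isometry U ->
  dot (U *m x) (U *m y) = dot x y.
Proof.
move=> [dU _].
have dotD (a b : 'cV[R]_n) : dot (a + b) (a + b) = dot a a + 2 * dot a b + dot b b.
  rewrite !dotE mulr_sumr -!big_split/=; apply: eq_bigr => i _; rewrite !mxE; ring.
have := dU (x + y); rewrite mulmxDr !dotD !dU => h; lra.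
Qed.

Lemma full_rank_inj n p (X : 'M[R]_(n, p)) (x : 'cV[R]_p) : \rank X = p ->
  X *m x = 0 -> x = 0.
Proof.
move=> rX Xx; apply/trmx_inj; rewrite trmx0; apply/eqP; rewrite -submx0.
have : row_free X^T by rewrite /row_free mxrank_tr rX.
rewrite -kermx_eq0 => /eqP <-; apply/sub_kermxP.
by rewrite -trmx_mul Xx trmx0.
Qed.

(** A vector [y] in the kernel of the top block satisfies [U X y = 0], the other rows being zero;
    then [X y] has norm 0, and the full column rank gives [y = 0]. *)
Lemma topmx_unit n p (pn : (p <= n)%N) (X : 'M[R]_(n, p)) (U : 'M[R]_n) :
  \rank X = p -> gauss_isometry U ->
  (forall (i : 'I_n) j, (p <= i)%N -> (U *m X) i j = 0) ->
  topmx pn (U *m X) \in unitmx.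
Proof.
move=> rX gU U0; rewrite -unitmx_tr -row_free_unit -kermx_eq0.
apply/eqP/row_matrixP => i; rewrite row0.
set x := row i _.
have xR : x *m (topmx pn (U *m X))^T = 0.
  by apply/sub_kermxP; exact: row_sub.
have : topmx pn (U *m X) *m x^T = 0.
  by rewrite -[LHS]trmxK trmx_mul trmxK xR trmx0.
suff y0 : topmx pn (U *m X) *m x^T = 0 -> x^T = 0.
  by move=> /y0 x0; rewrite -[x]trmxK x0 trmx0.
move: (x^T) => y Ry.
apply: (full_rank_inj rX).
have UXy : U *m (X *m y) = 0.
  apply/matrixP => k l; rewrite (ord1 l) mulmxA [LHS]mxE [RHS]mxE.
  have [kp|pk] := ltnP k p; last by rewrite big1// => j _; rewrite U0// mul0r.
  have h : (topmx pn (U *m X) *m y) (Ordinal kp) 0 = 0 by rewrite Ry mxE.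
  rewrite mxE in h; rewrite -[RHS]h; apply: eq_bigr => j _.
  by rewrite [in RHS]mxE; congr ((U *m X) _ _ * _); exact: val_inj.
have d0 : dot (X *m y) (X *m y) = 0.
  by rewrite -(gauss_isometry_dot _ _ gU) UXy dotE big1// => j _; rewrite mxE mul0r.
apply/matrixP => k l; rewrite (ord1 l) [RHS]mxE.
move: d0; rewrite dotE => /eqP; rewrite psumr_eq0 => [/allP/(_ k)|j _]; last first.
  by rewrite -expr2 sqr_ge0.
by rewrite mem_index_enum => /(_ isT)/=; rewrite mulf_eq0 orbb => /eqP.
Qed.

(* In the rotated coordinates [z = U eps / sigma], this form yields
   [beta_hat_l - beta_l = sigma z_l / r],
   [Theta_hat - theta = sigma (c0 z_o + c1 z_l)], and [RSS / sigma ^ 2] is the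
   sum of the squares of the coordinates [z_i] with [p <= i]. *)
Record canonical_form n p (pn : (p <= n)%N) (X : 'M[R]_(n, p)) (a : 'cV[R]_p)
    (l o : 'I_p) (U : 'M[R]_n) (r c0 c1 : R) : Prop := CanonicalForm {
  cf_isometry : gauss_isometry U ;
  cf_zero : forall (i : 'I_n) j, (p <= i)%N -> (U *m X) i j = 0 ;
  cf_last : forall j, topmx pn (U *m X) l j = r *+ (j == l) ;
  cf_form : forall j, a j 0 = c0 * topmx pn (U *m X) o j + c1 * topmx pn (U *m X) l j
}.

(** The row [l] of the triangular factor [R1] has only its diagonal entry. Writing [a^T = c R1], a
    second isometry [V] gathers the entries of [c] before [l] in position [o]. It spoils the
    triangular shape above row [l] but touches neither that row nor the zero rows below. *)
Lemma canonical_form_exists n p (pn : (p <= n)%N) (X : 'M[R]_(n, p))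
    (a : 'cV[R]_p) (l o : 'I_p) : \rank X = p -> l.+1 = p -> o != l ->
  exists U r c0 c1, canonical_form pn X a l o U r c0 c1.
Proof.
move=> rX lp ol.
have [U1 g1 U1X] := triangularize X pn (leqnn p).
have U1z (i : 'I_n) j : (p <= i)%N -> (U1 *m X) i j = 0.
  by move=> pi; apply: U1X => //; exact: leq_trans pi.
have R1u := topmx_unit pn rX g1 U1z.
set R1 := topmx pn (U1 *m X) in R1u.
pose c := a^T *m invmx R1.
(* The row [c] is padded with zeros, since isometries act on vectors of length [n]. *)
pose v : 'cV[R]_n := \col_i (if insub (val i) is Some i' then c 0 i' else 0).
have vw i : v (widen_ord pn i) 0 = c 0 i by rewrite mxE valK.
have vz (i : 'I_n) : (p <= i)%N -> v i 0 = 0.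
  by move=> pi; rewrite mxE insubF// ltnNge pi.
have il (i : 'I_p) : (i < l)%N || (i == l) by have := ltn_ord i; rewrite -{2}lp ltnS leq_eqVlt => /orP[/eqP/val_inj ->|->]; rewrite ?eqxx ?orbT.
pose s := [seq i : 'I_n <- enum 'I_n | (i < l)%N && (i != widen_ord pn o)].
have os : widen_ord pn o \notin s by rewrite mem_filter eqxx andbF.
have ltol : (o < l)%N.
  by have := ltn_ord o; rewrite -{2}lp ltnS leq_eqVlt => /orP[/eqP/val_inj/eqP|//]; rewrite (negbTE ol).
have [V [gV Vv Vo _]] := kill_entries v os.
have Vfix (x : 'cV[R]_n) (k : 'I_n) : (l <= k)%N -> (V *m x) k 0 = x k 0.
  move=> lk; apply: Vo; rewrite inE mem_filter negb_or ltnNge lk /= andbT.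
  by apply: contraTneq lk => ->; rewrite -ltnNge.
have VUX (k : 'I_n) j : (l <= k)%N -> (V *m U1 *m X) k j = (U1 *m X) k j.
  move=> lk; have := Vfix (col j (U1 *m X)) k lk; rewrite [X in _ = X]mxE => <-.
  by rewrite -mulmxA !mxE; apply: eq_bigr => i _; rewrite [in RHS]mxE.
have gVU := gauss_isometryM gV g1.
exists (V *m U1), (R1 l l), ((V *m v) (widen_ord pn o) 0), (c 0 l); split => //.
- by move=> i j pi; rewrite VUX ?U1z// (leq_trans _ pi)// ltnW.
- move=> j; rewrite mxE VUX//; case: eqVneq => [->|jl].
    by rewrite mulr1n [RHS]mxE.
  apply: U1X => //=.
  by have := il j; rewrite /= -val_eqE in jl *; rewrite (negbTE jl) orbF.
- move=> j.
  have aE : a j 0 = \sum_i c 0 i * R1 i j.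
    have : a^T = c *m R1 by rewrite /c -mulmxA mulVmx// mulmx1.
    by move=> /matrixP/(_ 0 j); rewrite mxE => ->; rewrite mxE.
  (* Isometries preserve this inner product, and [V *m v] is supported on [o] and [l]: its expansion
     has just the two terms of [cf_form]. *)
  have : dot (V *m v) (col j (V *m U1 *m X)) = a j 0.
    rewrite -mulmxA col_mulmx.
    rewrite gauss_isometry_dot// dotE aE (sum_widen pn); last first.
      by move=> i pi; rewrite vz// mul0r.
    by apply: eq_bigr => i _; rewrite vw !mxE.
  move=> <-; rewrite dotE (sum_widen pn); last first.
    by move=> i pi; rewrite Vfix ?vz ?mul0r// (leq_trans _ pi)// ltnW.
  rewrite (bigD1 o)//= (bigD1 l)/=; last by rewrite eq_sym.
  rewrite big1 ?addr0 => [|i /andP[io ilN]].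
    have tE i : col j (V *m U1 *m X) (widen_ord pn i) 0 = topmx pn (V *m U1 *m X) i j.
      by rewrite mxE [RHS]mxE.
    by rewrite !tE (Vfix v (widen_ord pn l))//= vw.
  rewrite Vv ?mul0r// mem_filter mem_enum andbT/=.
  by have := il i; rewrite (negbTE ilN) orbF => ->.
Qed.

Lemma canonical_form_sign n p (pn : (p <= n)%N) (X : 'M[R]_(n, p))
    (a : 'cV[R]_p) (l o : 'I_p) (e : 'I_p -> bool) U r c0 c1 :
  canonical_form pn X a l o U r c0 c1 ->
  exists V, canonical_form pn X a l o V
    ((-1) ^+ e l * r) ((-1) ^+ e o * c0) ((-1) ^+ e l * c1).
Proof.
move=> [gU Uz Ul Uf].
pose e' (i : 'I_n) := if insub (val i) is Some i' then e i' else false.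
have e'w i : e' (widen_ord pn i) = e i by rewrite /e' valK.
have sE i j : (sign_mx e' *m U *m X) i j = (-1) ^+ e' i * (U *m X) i j.
  by rewrite -mulmxA mul_diag_mx mxE [in LHS]mxE.
have tE i j : topmx pn (sign_mx e' *m U *m X) i j = (-1) ^+ e i * topmx pn (U *m X) i j.
  by rewrite mxE sE e'w [in RHS]mxE.
exists (sign_mx e' *m U); split.
- by apply: gauss_isometryM => //; exact: gauss_isometry_sign.
- by move=> i j pi; rewrite sE Uz// mulr0.
- by move=> j; rewrite tE Ul mulrnAr.
- move=> j; rewrite !tE Uf !mulrA.
  by rewrite ![_ * _ * (-1) ^+ _]mulrAC -!expr2 !sqrr_sign !mul1r.
Qed.

(** Sign changes make [sqrt v22] and the square root of [vK] for [{p}] equal to [r^-1] and [c0],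
    without absolute values. The coefficient [r] cannot vanish, by invertibility of the top block,
    but [c0] can: this is the case [|rho| = 1]. *)
Lemma canonical_form_pos n p (pn : (p <= n)%N) (X : 'M[R]_(n, p))
    (a : 'cV[R]_p) (l o : 'I_p) : \rank X = p -> l.+1 = p -> o != l ->
  exists U r c0 c1, [/\ canonical_form pn X a l o U r c0 c1, 0 < r & 0 <= c0].
Proof.
move=> rX lp ol; have [U [r [c0 [c1 cf]]]] := canonical_form_exists pn a rX lp ol.
have rN0 : r != 0.
  apply/eqP => r0; have [gU Uz Ul _] := cf.
  have := topmx_unit pn rX gU Uz; rewrite unitmxE.
  suff -> : \det (topmx pn (U *m X)) = 0 by rewrite unitr0.
  rewrite (expand_det_row _ l) big1// => j _.
  by rewrite Ul r0 mul0rn mul0r.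
pose e i := if i == l then r < 0 else c0 < 0.
have [V cfV] := canonical_form_sign e cf.
do 4 eexists; split; first exact: cfV.
  rewrite /e eqxx; case: (ltP r 0) => r0; rewrite ?mul1r ?mulN1r ?oppr_gt0//.
  by rewrite lt_neqAle eq_sym rN0.
by rewrite /e (negbTE ol); case: (ltP c0 0) => // c00; rewrite ?mul1r// mulN1r oppr_ge0 ltW.
Qed.

End triangular.

(** * Moments and chi-squared laws *)

Section moments.
Context d (T : measurableType d) (R : realType) (P : probability T R).
Local Notation RM := (measurableTypeR R).

Lemma Lfun2_of_sqr (f : T -> R) : measurable_fun setT (f : T -> RM) ->
  (\int[P]_w (f w ^+ 2)%:E < +oo)%E -> f \in Lfun P 2%:E.
Proof.
move=> mf foo; rewrite inE; apply/andP; split; rewrite inE//=.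
rewrite /finite_norm unlock /Lnorm poweR_lty//.
under eq_integral => x _ do rewrite /= powR_mulrn ?normr_ge0// real_normK ?num_real//.
exact: foo.
Qed.

Variables (Z1 Z2 : T -> R).
Hypotheses (L1 : Z1 \in Lfun P 2%:E) (L2 : Z2 \in Lfun P 2%:E).
Hypotheses (E1 : ('E_P[Z1] = 0)%E) (E2 : ('E_P[Z2] = 0)%E)
  (E11 : ('E_P[Z1 \* Z1] = 1)%E) (E22 : ('E_P[Z2 \* Z2] = 1)%E)
  (E12 : ('E_P[Z1 \* Z2] = 0)%E).

Lemma expectation_affine (x a b : R) :
  ('E_P[fun w => (x + a * Z1 w + b * Z2 w)%R] = x%:E)%E.
Proof.
have l1 : Z1 \in Lfun P 1 by apply: Lfun_subset12 => //; exact: fin_num_measure.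
have l2 : Z2 \in Lfun P 1 by apply: Lfun_subset12 => //; exact: fin_num_measure.
have -> : (fun w => (x + a * Z1 w + b * Z2 w)%R) = ((cst x \+ a \o* Z1) \+ b \o* Z2)%R.
  by apply/funext => w /=; rewrite (mulrC a) (mulrC b).
rewrite !expectationD ?expectationZl ?Lfun_scale//= ?rpredD ?Lfun_scale ?Lfun_cst//.
by rewrite expectation_cst E1 E2 !mule0 !adde0.
Qed.

(** All the estimators concerned are affine in [z_l] and [z_o], so this one formula yields every
    variance and covariance of the model. *)
Lemma cov_affine (x a b y c e : R) :
  cov P (fun w => x + a * Z1 w + b * Z2 w) (fun w => y + c * Z1 w + e * Z2 w) =
  a * c + b * e.
Proof.
rewrite /cov unlock !expectation_affine /=.
rewrite [X in ('E_P[X])%E](_ : _ = ((a * c) \o* (Z1 \* Z1) \+ (b * e) \o* (Z2 \* Z2))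
   \+ (a * e + b * c) \o* (Z1 \* Z2)); last first.
  by apply/funext => w /=; rewrite !fctE /=; ring.
have l11 := Lfun2_mul_Lfun1 L1 L1.
have l12 := Lfun2_mul_Lfun1 L1 L2.
have l22 := Lfun2_mul_Lfun1 L2 L2.
rewrite !expectationD ?expectationZl ?Lfun_scale//= ?rpredD ?Lfun_scale//.
by rewrite E11 E22 E12 mule0 !mule1 adde0.
Qed.
End moments.

Section iid_moments.
Context d (T : measurableType d) (R : realType) (P : probability T R).
Notation N01 := (normal_prob (0 : R) 1).
Local Notation RM := (measurableTypeR R).
Context n (z : 'I_n -> T -> R).
Hypothesis iidz : std_iid P z.

Lemma std_iid_pair (i j : 'I_n) (E : set (R * R)) : i != j ->
  measurable (E : set (RM * RM)) ->
  P [set w | E (z i w, z j w)] = ((N01 \x N01) E)%E.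
Proof.
move=> ij mE.
have := std_iid_plane iidz (A := fun=> setT) ij (fun=> measurableT) mE.
rewrite big1 ?mul1e => [<-|k _]; last exact: probability_setT.
by congr (P _); apply/seteqP; split => w //= [].
Qed.

Lemma std_iid_single (i : 'I_n) (A : set R) : measurable (A : set RM) ->
  P [set w | A (z i w)] = N01 A.
Proof.
move=> mA; have [mz zE] := iidz.
pose A' k := if k == i then A else setT.
have mA' k : measurable (A' k : set RM) by rewrite /A'; case: ifP.
transitivity (P [set w | forall k, A' k (z k w)]).
  congr (P _); apply/seteqP; split => w /=.
    by move=> h k; rewrite /A'; case: eqVneq => [->|].
  by move=> /(_ i); rewrite /A' eqxx.
rewrite zE// (bigD1 i)//= /A' eqxx big1 ?mule1// => k /negbTE ->.
exact: probability_setT.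
Qed.

Lemma std_iid_sqr i : ('E_P[z i \* z i] = 1)%E.
Proof.
have [mz zE] := iidz; rewrite unlock -integral_sqr_normal.
transitivity (\int[pushforward P (z i : T -> RM)]_x (x ^+ 2)%:E)%E.
  rewrite ge0_integral_pushforward//.
  - by apply/measurable_EFinP; exact: measurable_funX.
  - by move=> x _; rewrite lee_fin sqr_ge0.
by apply: eq_measure_integral => A mA _; exact: (std_iid_single i mA).
Qed.

Lemma std_iid_Lfun2 i : z i \in Lfun P 2%:E.
Proof.
have [mz _] := iidz; apply: Lfun2_of_sqr => //.
have := std_iid_sqr i; rewrite unlock => h.
under eq_integral do rewrite expr2.
by rewrite h ltry.
Qed.

End iid_moments.

Section iid_moments2.
Context d (T : measurableType d) (R : realType) (P : probability T R).
Local Notation RM := (measurableTypeR R).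
Context n (z : 'I_n -> T -> R).
Hypothesis iidz : std_iid P z.
Variable i : 'I_n.

Let z' k w := if k == i then - z k w else z k w.

Let iidz' : std_iid P z'.
Proof. exact: (std_iid_sign iidz (fun k => k == i)). Qed.

(** Changing the sign of [z i] preserves the law and negates the mean, which is finite. *)
Lemma std_iid_mean : ('E_P[z i] = 0)%E.
Proof.
have [[mz _] [mz' _]] := (iidz, iidz').
have l1 : z i \in Lfun P 1.
  by apply: Lfun_subset12 => //; [exact: fin_num_measure|exact: std_iid_Lfun2 iidz i].
have l1' : z' i \in Lfun P 1.
  by apply: Lfun_subset12 => //; [exact: fin_num_measure|exact: std_iid_Lfun2 iidz' i].
have e : ('E_P[z i] = 'E_P[z' i])%E.
  rewrite unlock.
  transitivity (\int[pushforward P (z i : T -> RM)]_x x%:E)%E.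
    by rewrite integral_pushforward//; exact/Lfun1_integrable.
  transitivity (\int[pushforward P (z' i : T -> RM)]_x x%:E)%E; last first.
    by rewrite integral_pushforward//; exact/Lfun1_integrable.
  apply: eq_measure_integral => A mA _.
  exact: etrans (std_iid_single iidz i mA) (esym (std_iid_single iidz' i mA)).
have e2 : ('E_P[z' i] = - 'E_P[z i])%E.
  rewrite -[RHS]mulN1e -expectationZl//; congr expectation.
  by apply/funext => w; rewrite /z' eqxx /= mulrN1.
have : ('E_P[z i])%E \is a fin_num by exact: expectation_fin_num.
move: e; rewrite e2; case: ('E_P[z i])%E => // r.
by rewrite -EFinN => -[h] _; congr EFin; lra.
Qed.

(** The sign change at [i] alone preserves the law of the pair and negates the mean of the
    product. *)
Lemma std_iid_uncorr j : i != j -> ('E_P[z i \* z j] = 0)%E.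
Proof.
move=> ij; have [[mz _] [mz' _]] := (iidz, iidz').
have l1 : z i \* z j \in Lfun P 1.
  by apply: Lfun2_mul_Lfun1; exact: std_iid_Lfun2.
have l1' : z' i \* z' j \in Lfun P 1.
  by apply: Lfun2_mul_Lfun1; exact: std_iid_Lfun2.
have m1 : measurable_fun setT (fun w => (z i w, z j w) : RM * RM).
  exact: measurable_fun_pair.
have m2 : measurable_fun setT (fun w => (z' i w, z' j w) : RM * RM).
  exact: measurable_fun_pair.
have mf : measurable_fun setT (fun x : RM * RM => (x.1 * x.2)%:E).
  by apply/measurable_EFinP; exact: measurable_funM.
have e : ('E_P[z i \* z j] = 'E_P[z' i \* z' j])%E.
  rewrite unlock.
  transitivity (\int[pushforward P (fun w => (z i w, z j w) : RM * RM)]_x (x.1 * x.2)%:E)%E.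
    by rewrite integral_pushforward//; exact/Lfun1_integrable.
  transitivity (\int[pushforward P (fun w => (z' i w, z' j w) : RM * RM)]_x (x.1 * x.2)%:E)%E; last first.
    by rewrite integral_pushforward//; exact/Lfun1_integrable.
  apply: eq_measure_integral => A mA _.
  exact: etrans (std_iid_pair iidz ij mA) (esym (std_iid_pair iidz' ij mA)).
have e2 : ('E_P[z' i \* z' j] = - 'E_P[z i \* z j])%E.
  rewrite -[RHS]mulN1e -expectationZl//; congr expectation.
  apply/funext => w; rewrite /z' /= eqxx eq_sym (negbTE ij).
  by rewrite mulrN1 mulNr.
have : ('E_P[z i \* z j])%E \is a fin_num by exact: expectation_fin_num.
move: e; rewrite e2; case: ('E_P[z i \* z j])%E => // r.
by rewrite -EFinN => -[h] _; congr EFin; lra.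
Qed.

End iid_moments2.

Section chi2.
Context d (T : measurableType d) (R : realType) (P : probability T R).
Notation N01 := (normal_prob (0 : R) 1).
Local Notation RM := (measurableTypeR R).
Context n (z : 'I_n -> T -> R).
Hypothesis iidz : std_iid P z.

Definition sum_sqr (s : seq 'I_n) (w : T) : R := \sum_(i <- s) z i w ^+ 2.

Lemma measurable_sum_sqr s : measurable_fun setT (sum_sqr s : T -> RM).
Proof.
have [mz _] := iidz; apply: measurable_sum => i.
exact: (measurable_funX 2 (mz i)).
Qed.

(** Induction on [s], with [A] and [B] general. Only coordinates outside [s] may be constrained,
    since those in [s] are consumed by the sum. The recursion of [chi2_law] is matched by taking the
    joint law of [z i] and the sum over the remaining indices. *)
Lemma chi2_indep (s : seq 'I_n) (A : 'I_n -> set R) (B : set R) : uniq s ->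
  (forall i, measurable (A i : set RM)) -> measurable (B : set RM) ->
  (forall i, i \in s -> A i = setT) ->
  P [set w | (forall i, A i (z i w)) /\ B (sum_sqr s w)] =
  ((\prod_i N01 (A i)) * chi2_law R (size s) B)%E.
Proof.
have [mz zE] := iidz; have msq := measurable_sum_sqr.
elim: s A B => [|i s IHs] A B /= us mA mB AT.
  rewrite diracE -zE//; have [B0|B0] := boolP (0 \in B).
    rewrite mule1; congr (P _); apply/seteqP; split => w /=; first by case.
    by move=> h; split => //; rewrite /sum_sqr big_nil -[B 0]in_setE.
  rewrite mule0 [X in P X](_ : _ = set0) ?measure0//.
  apply/seteqP; split => w //= -[_]; rewrite /sum_sqr big_nil.
  by move=> /mem_set; rewrite (negbTE B0).
case/andP: us => si us.
pose D := [set w | forall k, A k (z k w)].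
have mD : measurable D.
  rewrite (_ : D = [set w | forall k, predT k -> A k (z k w)]).
    exact: measurable_forall_ord.
  by apply/seteqP; split => w h k; [move=> _|]; exact: h.
have mp : measurable_fun setT (fun w => (z i w, sum_sqr s w) : RM * RM).
  exact: measurable_fun_pair.
have mE : measurable (@add_sqr R @^-1` B) by exact: measurable_preimageT.
pose m := pushforward (mrestr P mD) (fun w => (z i w, sum_sqr s w) : RM * RM).
transitivity (m (@add_sqr R @^-1` B)).
  rewrite /m /pushforward /mrestr /=; congr (P _).
  apply/seteqP; split => w /=.
    by move=> [h1 h2]; split => //; rewrite /add_sqr/=; move: h2; rewrite /sum_sqr big_cons.
  by move=> [h1 h2]; split => //; rewrite /sum_sqr big_cons.
rewrite /m; apply: product_prob_unique => //.
- exact: prod_prob_ge0.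
- exact: prod_prob_lty.
move=> B1 B2 mB1 mB2 /=.
(* The slot [i] is free, as [A i] is the whole line, and it is below the reach of the shorter sum:
   the induction hypothesis allows [B1] there. *)
pose A' k := if k == i then B1 else A k.
have mA' k : measurable (A' k : set RM) by rewrite /A'; case: ifP.
transitivity (P [set w | (forall k, A' k (z k w)) /\ B2 (sum_sqr s w)]).
  rewrite /pushforward /mrestr /=; congr (P _); apply/seteqP; split => w /=.
    move=> [[h1 h2] h3]; split => // k; rewrite /A'; case: eqVneq => [->//|ki].
    exact: h3.
  move=> [h h2]; split; first by split => //; have := h i; rewrite /A' eqxx.
  move=> k; have := h k; rewrite /A'; case: eqVneq => [-> _|//].
  by rewrite AT ?mem_head.
rewrite IHs//; last first.
  move=> k ks; rewrite /A'; case: eqVneq => [ki|ki]; first by rewrite -ki ks in si.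
  by apply: AT; rewrite inE ks orbT.
rewrite (bigD1 i)//= [X in _ = (X * _)%E](bigD1 i)//= AT ?mem_head// /A' eqxx.
rewrite [N01 setT](_ : _ = 1%E); last exact: probability_setT.
rewrite mul1e -muleA muleCA; congr (_ * _)%E.
by apply: eq_bigr => k /negbTE ->.
Qed.

(* The law of [(RSS / sigma ^ 2, (z_l, z_o))], with the chi-squared component
   first so that the outer integral of the product measure is over W. *)
Definition joint_law (m : nat) : set (RM * (RM * RM)) -> \bar R :=
  (chi2_law R m \x (N01 \x N01))%E.

Lemma joint_lawE (s : seq 'I_n) (i j : 'I_n) (E : set (R * (R * R))) :
  uniq s -> i != j -> i \notin s -> j \notin s ->
  measurable (E : set (RM * (RM * RM))) ->
  P [set w | E (sum_sqr s w, (z i w, z j w))] = joint_law (size s) E.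
Proof.
move=> us ij si sj mE; have [mz zE] := iidz; have msq := measurable_sum_sqr.
have mzz : measurable_fun setT (fun w => (z i w, z j w) : RM * RM).
  exact: measurable_fun_pair.
have mp : measurable_fun setT (fun w => (sum_sqr s w, (z i w, z j w)) : RM * (RM * RM)).
  exact: measurable_fun_pair.
(* Uniqueness is applied twice: here with the sum confined to [B], to pass from rectangles to all
   planar [F]; then to pass from products of [B] and [F] to all of [E]. *)
have step B F : measurable (B : set RM) -> measurable (F : set (RM * RM)) ->
    P [set w | B (sum_sqr s w) /\ F (z i w, z j w)] =
    (chi2_law R (size s) B * (N01 \x N01) F)%E.
  move=> mB mF.
  have mD : measurable [set w | B (sum_sqr s w)] by exact: (measurable_preimageT (msq s)).
  pose m := pushforward (mrestr P mD) (fun w => (z i w, z j w) : RM * RM).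
  transitivity (m F).
    rewrite /m /pushforward /mrestr /=; congr (P _).
    by apply/seteqP; split => w /= [].
  rewrite /m; apply: product_prob_unique => //.
    by rewrite (le_lt_trans (probability_le1 _ _))// ltry.
  move=> B1 B2 mB1 mB2 /=.
  pose A k := if k == i then B1 else if k == j then B2 else setT.
  have mA k : measurable (A k : set RM) by rewrite /A; case: ifP => // _; case: ifP.
  transitivity (P [set w | (forall k, A k (z k w)) /\ B (sum_sqr s w)]).
    rewrite /pushforward /mrestr /=; congr (P _); apply/seteqP; split => w /=.
      move=> [[h1 h2] h3]; split => // k; rewrite /A; case: eqVneq => [->//|ki].
      by case: eqVneq => [->//|].
    move=> [h h2]; split => //; split; first by have := h i; rewrite /A eqxx.
    by have := h j; rewrite /A eqxx eq_sym (negbTE ij).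
  rewrite chi2_indep//; last first.
    move=> k ks; rewrite /A; case: eqVneq => [ki|_]; first by rewrite -ki ks in si.
    by case: eqVneq => // kj; rewrite -kj ks in sj.
  rewrite (bigD1 i)//= (bigD1 j)/=; last by rewrite eq_sym.
  rewrite big1 => [|k /andP[/negbTE ki /negbTE kj]]; last first.
    by rewrite /A ki kj; exact: probability_setT.
  by rewrite /A eqxx eq_sym (negbTE ij) eqxx mule1 muleC.
pose m := pushforward P (fun w => (sum_sqr s w, (z i w, z j w)) : RM * (RM * RM)).
transitivity (m E) => //; rewrite /joint_law -[RHS]mul1e /m.
apply: product_prob_unique => //; first by rewrite ltry.
move=> B F mB mF /=.
by rewrite mul1e -step.
Qed.
End chi2.

Section model.
Context (R : realType) (n p : nat) (X : 'M[R]_(n, p)) (M : gauss_model X).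

Lemma model_iid : std_iid (Pr M) (fun i w => eps M i w / sigma M).
Proof.
have s0 := sigma_gt0 M; split.
  by move=> i; apply: measurable_funM => //.
move=> A mA.
pose A' i := [set x : measurableTypeR R | A i (x / sigma M)].
have mA' i : measurable (A' i).
  apply: (@measurable_preimageT _ _ _ _ (fun x : measurableTypeR R => x / sigma M : measurableTypeR R)) => //.
  by apply: measurable_funM.
have := @eps_indep _ _ _ _ M finset.setT A' mA'.
rewrite [X in Pr M X = _](_ : _ = [set w | forall i, A i (eps M i w / sigma M)]); last first.
  by apply/seteqP; split => w /= h i; [apply: h; rewrite inE|move=> _; exact: h].
move=> ->; apply: eq_big => [i|i _]; first by rewrite finset.in_setT.
have := @eps_normal _ _ _ _ M i (A' i) (mA' i); rewrite /distribution /pushforward => ->.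
rewrite normal_prob_affine//; last exact: mA'. 
congr (normal_prob _ _ _).
by apply/seteqP; split => x /=; rewrite /A'/= addr0 mulrAC divff ?gt_eqF// mul1r.
Qed.
End model.

(** * Restricted least squares *)

Section lse.
Context {R : realType} (n p : nat) (pn : (p <= n)%N) (X : 'M[R]_(n, p)) (a : 'cV[R]_p).
Variables (l o : 'I_p) (U : 'M[R]_n) (r c0 c1 : R).
Hypotheses (rX : \rank X = p) (cf : canonical_form pn X a l o U r c0 c1) (r0 : r != 0).

Let Rm := topmx pn (U *m X).

(** A boolean encodes the two candidate sets, so that the full and the restricted fit share all the
    lemmas below. *)
Definition drop_last (b : bool) : {set 'I_p} := if b then [set l]%SET else finset.set0.

Lemma mem_drop_last b i : (i \in drop_last b) = b && (i == l).
Proof. by rewrite /drop_last; case: b; rewrite ?finset.in_set1// finset.in_set0. Qed.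

Definition tail_sqr (y : 'cV[R]_n) : R := \sum_(i < n | (p <= i)%N) y i 0 ^+ 2.

Lemma sum_pn (f : 'I_n -> R) :
  \sum_i f i = \sum_i f (widen_ord pn i) + \sum_(i < n | (p <= i)%N) f i.
Proof.
rewrite (bigID (fun i : 'I_n => (i < p)%N))/=; congr (_ + _).
  rewrite big_mkcond (sum_widen pn) => [|i pi]; last by rewrite ltnNge pi.
  by apply: eq_bigr => i _ /=; rewrite ltn_ord.
by apply: eq_bigl => i; rewrite -leqNgt.
Qed.

Lemma mul_widen (b : 'cV[R]_p) i : (U *m (X *m b)) (widen_ord pn i) 0 = (Rm *m b) i 0.
Proof.
rewrite mulmxA [LHS]mxE [RHS]mxE; apply: eq_bigr => j _.
by rewrite [in RHS]mxE.
Qed.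

Lemma mul_tail (b : 'cV[R]_p) (i : 'I_n) : (p <= i)%N -> (U *m (X *m b)) i 0 = 0.
Proof.
by move=> pi; rewrite mulmxA mxE big1// => j _; rewrite (cf_zero cf)// mul0r.
Qed.

Lemma mul_last (b : 'cV[R]_p) : (Rm *m b) l 0 = r * b l 0.
Proof.
rewrite mxE; under eq_bigr do rewrite (cf_last cf).
exact: (sum_pick l r (fun j => b j 0)).
Qed.

Lemma mul_form (b : 'cV[R]_p) : dot a b = c0 * (Rm *m b) o 0 + c1 * (Rm *m b) l 0.
Proof.
rewrite dotE [X in c0 * X]mxE [X in c1 * X]mxE !mulr_sumr -big_split/=.
by apply: eq_bigr => j _; rewrite (cf_form cf) mulrDl !mulrA.
Qed.

(** The best attainable value of [Rm *m b]: since row [l] of [Rm] is [r * e_l], the constraint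
    [b l 0 = 0] just forces the coordinate [l] of [Rm *m b] to be 0. *)
Definition fit (K : bool) (y : 'cV[R]_n) : 'cV[R]_p :=
  \col_i (if K && (i == l) then 0 else (U *m y) (widen_ord pn i) 0).

Lemma fitE K y i :
  fit K y i 0 = if K && (i == l) then 0 else (U *m y) (widen_ord pn i) 0.
Proof. by rewrite mxE. Qed.

(** Pythagoras in rotated coordinates: the first sum is what a feasible [b] can influence, the
    bracket is the irreducible residual. *)
Lemma sum_sqE K (y : 'cV[R]_n) (b : 'cV[R]_p) : (forall i, i \in drop_last K -> b i 0 = 0) ->
  sum_sq X y b = \sum_i (fit K y i 0 - (Rm *m b) i 0) ^+ 2 +
    ((U *m y) (widen_ord pn l) 0 ^+ 2 *+ K + tail_sqr (U *m y)).
Proof.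
move=> bK; rewrite /sum_sq -(gauss_isometry_dot _ _ (cf_isometry cf)) dotE sum_pn.
have subE m (u v : 'cV[R]_m) i : (u - v) i 0 = u i 0 - v i 0 by rewrite !mxE.
rewrite [RHS]addrA; congr (_ + _); last first.
  by apply: eq_bigr => i pi; rewrite mulmxBr subE mul_tail// subr0 -expr2.
under eq_bigr do rewrite mulmxBr subE mul_widen -expr2.
rewrite (bigD1 l)//= [in RHS](bigD1 l)//= [RHS]addrAC; congr (_ + _).
  rewrite fitE eqxx andbT mul_last; case: K bK => /= bK; last by rewrite mulr0n addr0.
  have -> : b l 0 = 0 by apply: bK; rewrite (mem_drop_last true) eqxx.
  by rewrite mulr0 !subr0 expr0n add0r.
by apply: eq_bigr => i /negbTE il; rewrite fitE il andbF.
Qed.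

Lemma fit_feasible K y i : i \in drop_last K -> (invmx Rm *m fit K y) i 0 = 0.
Proof.
rewrite mem_drop_last => /andP[KT /eqP ->].
apply: (mulfI r0); rewrite mulr0 -mul_last mulKVmx ?topmx_unit//.
- by rewrite fitE KT eqxx.
- exact: cf_isometry cf.
- exact: cf_zero cf.
Qed.

Lemma Rm_unit : Rm \in unitmx.
Proof. by apply: topmx_unit => //; [exact: cf_isometry cf|exact: cf_zero cf]. Qed.

Lemma sum_sq_fit K y : sum_sq X y (invmx Rm *m fit K y) =
  (U *m y) (widen_ord pn l) 0 ^+ 2 *+ K + tail_sqr (U *m y).
Proof.
rewrite (@sum_sqE K); last by move=> i; exact: fit_feasible.
by rewrite mulKVmx ?Rm_unit// big1 ?add0r// => i _; rewrite subrr expr0n.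
Qed.

Lemma lseE K (y : 'cV[R]_n) : lse X (drop_last K) y = invmx Rm *m fit K y.
Proof.
apply: xget_unique.
  split; first by move=> i; exact: fit_feasible.
  move=> c cK; rewrite sum_sq_fit (sum_sqE y cK) lerDr.
  by apply: sumr_ge0 => i _; rewrite sqr_ge0.
move=> b [bK bmin]; have := bmin _ (fun i => @fit_feasible K y i).
rewrite sum_sq_fit (sum_sqE y bK) gerDr => sb.
suff <- : Rm *m b = fit K y by rewrite mulKmx ?Rm_unit.
apply/matrixP => i k; rewrite (ord1 k).
have : \sum_i (fit K y i 0 - (Rm *m b) i 0) ^+ 2 == 0.
  by rewrite eq_le sb sumr_ge0// => j _; rewrite sqr_ge0.
rewrite psumr_eq0 => [/allP/(_ i)|j _]; last by rewrite sqr_ge0.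
by rewrite mem_index_enum => /(_ isT)/=; rewrite sqrf_eq0 subr_eq0 => /eqP.
Qed.

Lemma RSSE K y : RSS X (drop_last K) y =
  (U *m y) (widen_ord pn l) 0 ^+ 2 *+ K + tail_sqr (U *m y).
Proof. by rewrite /RSS lseE sum_sq_fit. Qed.

Lemma dot_lseE K y : dot a (lse X (drop_last K) y) =
  c0 * fit K y o 0 + c1 * fit K y l 0.
Proof. by rewrite lseE mul_form mulKVmx ?Rm_unit. Qed.

Lemma lse_lastE y : lse X finset.set0 y l 0 = (U *m y) (widen_ord pn l) 0 / r.
Proof.
have /= -> := lseE false y; apply: (mulfI r0).
by rewrite -mul_last mulKVmx ?Rm_unit// fitE /= mulrCA divff// mulr1.
Qed.
End lse.

(** * Estimators and their covariances in rotated coordinates *)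

Section model_values.
Context {R : realType} (n p : nat) (pn : (p <= n)%N) (X : 'M[R]_(n, p)) (a : 'cV[R]_p).
Variables (l o : 'I_p) (U : 'M[R]_n) (r c0 c1 : R).
Hypotheses (rX : \rank X = p) (cf : canonical_form pn X a l o U r c0 c1)
  (r0 : 0 < r) (c00 : 0 <= c0) (ol : o != l) (a0 : a != 0).
Variable M : gauss_model X.

Let rN0 : r != 0. Proof. by rewrite gt_eqF. Qed.

Lemma c0c1_gt0 : 0 < c0 ^+ 2 + c1 ^+ 2.
Proof.
rewrite lt_neqAle addr_ge0 ?sqr_ge0// andbT eq_sym.
apply: contra a0; rewrite paddr_eq0 ?sqr_ge0// !sqrf_eq0 => /andP[/eqP h0 /eqP h1].
by apply/eqP/matrixP => j k; rewrite (ord1 k) (cf_form cf) h0 h1 !mul0r addr0 mxE.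
Qed.

Definition zcoord (i : 'I_n) (w : Omega M) : R :=
  \sum_j U i j * (eps M j w / sigma M).

Lemma zcoord_iid : std_iid (Pr M) zcoord.
Proof. exact: (cf_isometry cf).2 (model_iid M). Qed.

Let wl := widen_ord pn l.
Let wo := widen_ord pn o.
Notation s := (sigma M).
Notation bl := (beta M l 0).

Let sN0 : s != 0. Proof. by rewrite gt_eqF// sigma_gt0. Qed.

Lemma mulUY w i : (U *m Y w) i 0 = (U *m (X *m beta M)) i 0 + s * zcoord i w.
Proof.
rewrite /Y mulmxDr mxE; congr (_ + _); rewrite mxE mulr_sumr.
by apply: eq_bigr => j _; rewrite mxE; field.
Qed.

Definition tail_idx : seq 'I_n := [seq i : 'I_n <- enum 'I_n | (p <= i)%N].

Lemma tail_sqrY w : tail_sqr p (U *m Y w) = s ^+ 2 * sum_sqr zcoord tail_idx w.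
Proof.
rewrite /tail_sqr /sum_sqr big_filter big_enum_cond mulr_sumr; apply: eq_bigr => i pi.
by rewrite mulUY (mul_tail cf)// add0r exprMn.
Qed.

Let S := sum_sqr zcoord tail_idx.

Lemma RSS0E w : RSS X finset.set0 (Y w) = s ^+ 2 * S w.
Proof. by have /= -> := RSSE rX cf rN0 false (Y w); rewrite mulr0n add0r tail_sqrY. Qed.

Lemma mulUYl w : (U *m Y w) wl 0 = r * bl + s * zcoord wl w.
Proof. by rewrite mulUY (mul_widen _ X) (mul_last cf). Qed.

Lemma RSS1E w : RSS X [set l]%SET (Y w) = (r * bl + s * zcoord wl w) ^+ 2 + s ^+ 2 * S w.
Proof.
by have /= -> := RSSE rX cf rN0 true (Y w); rewrite mulr1n tail_sqrY mulUYl.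
Qed.

Lemma thetaE : theta M a = c0 * (topmx pn (U *m X) *m beta M) o 0 + c1 * (r * bl).
Proof. by rewrite /theta (mul_form cf) (mul_last cf). Qed.

Lemma Theta0E : Theta_hat (M := M) a finset.set0 =
  fun w => theta M a + (c1 * s) * zcoord wl w + (c0 * s) * zcoord wo w.
Proof.
apply/funext => w; rewrite /Theta_hat.
have /= -> := dot_lseE rX cf rN0 false (Y w).
by rewrite !fitE /= mulUYl mulUY (mul_widen _ X) thetaE; ring.
Qed.

(** The restricted fit loses the contribution of coordinate [l], signal included: hence the bias
    [- c1 * (r * bl)]. The null coefficient keeps the shape required by [cov_coord]. *)
Lemma Theta1E : Theta_hat (M := M) a [set l]%SET =
  fun w => (theta M a - c1 * (r * bl)) + 0 * zcoord wl w + (c0 * s) * zcoord wo w.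
Proof.
apply/funext => w; rewrite /Theta_hat.
have /= -> := dot_lseE rX cf rN0 true (Y w).
by rewrite !fitE /= (negbTE ol) eqxx mulUY (mul_widen _ X) thetaE; ring.
Qed.

Lemma beta_hatE : beta_hat (M := M) l = fun w => bl + (s / r) * zcoord wl w + 0 * zcoord wo w.
Proof.
apply/funext => w; rewrite /beta_hat (lse_lastE rX cf rN0) mulUYl.
by field.
Qed.

Let wlo : wl != wo.
Proof. by apply: contra ol => /eqP /(congr1 val) /= h; apply/eqP/val_inj. Qed.

Lemma cov_coord (x b b' y c e : R) :
  cov (Pr M) (fun w => x + b * zcoord wl w + b' * zcoord wo w)
    (fun w => y + c * zcoord wl w + e * zcoord wo w) = b * c + b' * e.
Proof.
have zi := zcoord_iid.
apply: cov_affine; [exact: std_iid_Lfun2 zi _|exact: std_iid_Lfun2 zi _|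
  exact: std_iid_mean zi _|exact: std_iid_mean zi _|exact: std_iid_sqr zi _|
  exact: std_iid_sqr zi _|exact: std_iid_uncorr zi _ _ wlo].
Qed.

Lemma v11E : v11 M a = c0 ^+ 2 + c1 ^+ 2.
Proof. by rewrite /v11 Theta0E cov_coord; field. Qed.
Lemma v12E : v12 M a l = c1 / r.
Proof. by rewrite /v12 Theta0E beta_hatE cov_coord; field; rewrite rN0. Qed.
Lemma v22E : v22 M l = (r ^+ 2)^-1.
Proof. by rewrite /v22 beta_hatE cov_coord; field; rewrite rN0. Qed.
Lemma vK0E : vK M a finset.set0 = c0 ^+ 2 + c1 ^+ 2.
Proof. exact: v11E. Qed.
Lemma vK1E : vK M a [set l]%SET = c0 ^+ 2.
Proof. by rewrite /vK Theta1E cov_coord; field. Qed.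

Lemma sqrt_v22E : Num.sqrt (v22 M l) = r^-1.
Proof. by rewrite v22E -exprVn sqrtr_sqr ger0_norm// invr_ge0 ltW. Qed.

Lemma gammaE : gamma M l = r * bl / s.
Proof. by rewrite /gamma sqrt_v22E; field; rewrite sN0 rN0. Qed.

(** The right-hand side involves neither [beta] nor [sigma], so the correlation is common to all
    models with the design [X]. *)
Lemma rhoE : rho M a l = c1 / Num.sqrt (c0 ^+ 2 + c1 ^+ 2).
Proof.
have vg := c0c1_gt0.
rewrite /rho v12E sqrtrM ?v11E ?ltW// sqrt_v22E; field.
by rewrite rN0 gt_eqF ?sqrtr_gt0.
Qed.

End model_values.

(** * The coverage probability as an integral *)

Section selection_integral.
Context {R : realType}.
Notation mu := (@lebesgue_measure R).
Notation phi := (normal_pdf (0 : R) 1).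
Notation N01 := (normal_prob (0 : R) 1).
Local Notation RM := (measurableTypeR R).

Definition normal2 : probability (RM * RM)%type R := (N01 \x N01)%E.

Definition scaled (m : nat) (q : R) : R := Num.sqrt (q / m%:R).

Lemma measurable_sqrt : measurable_fun setT (Num.sqrt : RM -> RM).
Proof. by apply: continuous_measurable_fun; exact: sqrt_continuous. Qed.

Lemma measurable_scaled m : measurable_fun setT (scaled m : RM -> RM).
Proof.
apply: (measurableT_comp measurable_sqrt (g := fun q : RM => q / m%:R : RM)).
exact: measurable_funM.
Qed.

Lemma normal_point (c : R) : N01 [set c] = 0%E.
Proof.
by rewrite /normal_prob integral_set1.
Qed.

(* [kap h w] is the conditional probability of [F] given [H = h] and [W = w],
   where [H = z1 + g]. *)
Variables (m : nat) (c g : R) (F : set (RM * (RM * RM))) (kap : R -> R -> R).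
Variable fW : R -> R.
Hypotheses (mF : measurable F)
  (kapE : forall w z1, N01 [set z2 | F (w, (z1, z2))] = (kap (z1 + g) w)%:E)
  (mfW : measurable_fun setT (fW : RM -> RM)) (fW0 : forall w, 0 <= fW w)
  (pdfW : forall A : set RM, measurable A ->
     chi2_law R m [set q | A (scaled m q)] = (\int[mu]_(w in A) (fW w)%:E)%E).

Lemma kap_ge0 h w : 0 <= kap h w.
Proof. by have := kapE w (h - g); rewrite subrK -lee_fin => <-. Qed.

(** By [kapE], [kap] is the measure of the sections of [F], and section measures are measurable. *)
Lemma measurable_kap :
  measurable_fun setT (fun wz : RM * RM => kap (wz.2 + g) wz.1 : RM).
Proof.
pose G : set (RM * RM * RM) := (fun x => (x.1.1, (x.1.2, x.2)) : RM * (RM * RM)) @^-1` F.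
have mG : measurable G.
  apply: measurable_preimageT => //.
  apply: measurable_fun_pair; first exact: measurableT_comp.
  by apply: measurable_fun_pair => //; exact: measurableT_comp.
apply/measurable_EFinP.
rewrite (_ : EFin \o _ = (N01 \o xsection G)); first exact: measurable_fun_xsection.
apply/funext => -[w z1] /=; rewrite -kapE; congr (normal_prob _ _ _).
by apply/seteqP; split => z2 /=; rewrite /xsection /= in_setE.
Qed.

Definition sel_mass (w : R) : \bar R :=
  (N01 \x N01)%E [set z | `|z.1 + g| <= c * w /\ F (w, z)].

Definition sel_dens (w : R) : \bar R :=
  (\int[mu]_(x in `[(- c)%R, c]) (kap (w * x) w * phi (w * x - g) * w * fW w)%R%:E)%E.

Let selF : set (RM * (RM * RM)) := [set x | `|x.2.1 + g| <= c * x.1 /\ F x].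

Let mselF : measurable selF.
Proof.
apply: measurableI => //; apply: measurable_leset.
  apply: measurableT_comp => //; apply: measurable_funD => //.
  exact: (measurableT_comp measurable_fst measurable_snd).
exact: measurable_funM.
Qed.

Lemma measurable_sel_mass : measurable_fun setT (sel_mass : RM -> \bar R).
Proof.
rewrite (_ : sel_mass = (N01 \x N01)%E \o xsection selF).
  exact: (measurable_fun_xsection normal2 mselF).
apply/funext => w; rewrite /sel_mass /=; congr (product_measure1 _ _ _).
by apply/seteqP; split => z /=; rewrite /xsection /= in_setE.
Qed.

Lemma sel_mass_ge0 w : (0 <= sel_mass w)%E.
Proof. exact: measure_ge0. Qed.

Lemma measurable_kapw (w : R) :
  measurable_fun setT (fun z1 : RM => kap (z1 + g) w : RM).
Proof. exact: (measurable_fun_pair2 w measurable_kap). Qed.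

(** Conditioning on [z1] and substituting [z1 = w * x - g] turns [|z1 + g| <= c * w] into
    [|x| <= c]; the Jacobian is the factor [w]. *)
Lemma sel_massE w : 0 <= w -> sel_mass w =
  (\int[mu]_(x in `[(- c)%R, c]) (kap (w * x) w * phi (w * x - g) * w)%:E)%E.
Proof.
move=> w0.
pose D : set RM := [set z1 | `|z1 + g| <= c * w].
have mD : measurable D.
  by apply: measurable_leset => //; apply: measurableT_comp => //; exact: measurable_funD.
have mf : measurable_fun setT (fun z1 : RM => (kap (z1 + g) w * phi z1 : RM)).
  by apply: measurable_funM; [exact: measurable_kapw|exact: measurable_normal_pdf].
have -> : sel_mass w = (\int[mu]_(z1 in D) (kap (z1 + g) w * phi z1)%:E)%E.
  transitivity (\int[N01]_(z1 in D) (kap (z1 + g) w)%:E)%E; last first.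
    rewrite ge0_integral_normal//.
      by apply/measurable_funTS/measurable_EFinP; exact: measurable_kapw.
    by move=> z _; rewrite lee_fin kap_ge0.
  rewrite [RHS]integral_mkcond /sel_mass /product_measure1; apply: eq_integral => z1 _.
  rewrite patchE /=; case: ifPn => [|zD].
    rewrite inE /D/= => zD; rewrite -kapE; congr (normal_prob _ _ _).
    by apply/seteqP; split => z2 /=; rewrite /xsection/= in_setE /= => // -[].
  rewrite (_ : xsection _ _ = set0) ?measure0//.
  apply/seteqP; split => z2 //=; rewrite /xsection/= in_setE /= => -[zD' _].
  by move/negP: zD; rewrite inE.
rewrite integral_mkcond.
have mfD : measurable_fun setT ((fun z1 : RM => (kap (z1 + g) w * phi z1)%:E) \_ D).
  by apply/(measurable_restrictT _ _).1 => //; apply/measurable_funTS/measurable_EFinP.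
have fD0 z : (0 <= ((fun z1 : RM => (kap (z1 + g) w * phi z1)%:E) \_ D) z)%E.
  by rewrite patchE; case: ifP => // _; rewrite lee_fin mulr_ge0 ?kap_ge0 ?normal_pdf_ge0.
move: w0; rewrite le_eqVlt => /orP[/eqP w0|w0].
  (* At [w = 0] the substitution is degenerate, but both sides vanish: the domain [D] is the single
     point [- g]. *)
  rewrite -w0 [RHS]integral0_eq; last by move=> x _; rewrite mulr0.
  rewrite -integral_mkcond (_ : D = [set - g]) ?integral_set1//.
  apply/seteqP; split => z /=; rewrite /D /= -w0 mulr0 normr_le0 addr_eq0.
    by move/eqP.
  by move=> ->.
rewrite (ge0_integral_affine (- g) w0)// -ge0_integralZl_EFin ?(ltW w0)//; last first.
  by apply: (measurableT_comp mfD (g := fun x : RM => w * x - g : RM)); exact: measurable_affine.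
rewrite [RHS]integral_mkcond; apply: eq_integral => x _; rewrite !patchE.
have -> : (x \in `[- c, c]%classic) = (`|w * x| <= c * w).
  by rewrite mem_setE in_itv/= normrM (gtr0_norm w0) mulrC ler_pM2r// ler_norml.
have -> : (w * x - g \in D) = (`|w * x| <= c * w).
  by apply/idP/idP; rewrite inE /D/= subrK.
by case: ifP => _; rewrite ?mule0// -EFinM subrK mulrC.
Qed.

Lemma measurable_dens w :
  measurable_fun setT (fun x : RM => kap (w * x) w * phi (w * x - g) * w : RM).
Proof.
have ma := measurable_affine w (- g).
apply: measurable_funM => //; apply: measurable_funM; last first.
  exact: (measurableT_comp (measurable_normal_pdf 0 1) ma).
rewrite (_ : (fun x => _) = (fun z1 => kap (z1 + g) w) \o (fun x => w * x - g)).
  exact: (measurableT_comp (measurable_kapw w) ma).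
by apply/funext => x /=; rewrite subrK.
Qed.

Lemma sel_mass_dens w : 0 <= w -> (sel_mass w * (fW w)%:E)%E = sel_dens w.
Proof.
move=> w0; rewrite sel_massE// -ge0_integralZr//.
- by apply/measurable_funTS/measurable_EFinP; exact: measurable_dens.
- by move=> x _; rewrite lee_fin !mulr_ge0 ?kap_ge0 ?normal_pdf_ge0.
- by rewrite lee_fin.
Qed.

(** Integration over the chi-squared component is rewritten over [w = scaled m q], whose law has
    density [fW]; the half-line loses nothing, a square root being nonnegative. *)
Lemma joint_sel : @joint_law R m
    [set x | `|x.2.1 + g| <= c * scaled m x.1 /\ F (scaled m x.1, x.2)] =
  (\int[mu]_(w in `[0%R, +oo[) sel_dens w)%E.
Proof.
transitivity (\int[chi2_law R m]_q sel_mass (scaled m q))%E.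
  rewrite /joint_law {1}/product_measure1; apply: eq_integral => q _ /=.
  congr (product_measure1 _ _ _).
  by apply/seteqP; split => z /=; rewrite /xsection /= in_setE.
transitivity (\int[pushforward (chi2_law R m) (scaled m : RM -> RM)]_(w in `[0%R, +oo[) sel_mass w)%E.
  rewrite ge0_integral_pushforward//.
  - have -> : (scaled m : RM -> RM) @^-1` `[0%R, +oo[ = setT; last by [].
    by apply/seteqP; split => q //= _; rewrite in_itv/= andbT sqrtr_ge0.
  - exact: measurable_scaled.
  - by apply: measurable_funTS; exact: measurable_sel_mass.
transitivity (\int[mu]_(w in `[0%R, +oo[) (sel_mass w * (fW w)%:E))%E.
  apply: ge0_integral_density => //.
  - exact: measurable_scaled.
  - by apply: measurable_funTS; exact: measurable_sel_mass.
by apply: eq_integral => w; rewrite inE/= in_itv/= andbT => w0; exact: sel_mass_dens.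
Qed.

End selection_integral.

(** * Null events of the chi-squared law *)

Section chi2_null.
Context {R : realType}.
Notation N01 := (normal_prob (0 : R) 1).
Local Notation RM := (measurableTypeR R).

Lemma chi2_lt0 m : chi2_law R m [set q : RM | q < 0] = 0%E.
Proof.
have mlt : measurable [set q : RM | q < 0].
  by rewrite (_ : [set q | q < 0] = `]-oo, 0[%classic)//; apply/seteqP; split => q; rewrite /= in_itv.
elim: m => [|m IHm] /=.
  by rewrite diracE memNset//= ltxx.
rewrite /distribution /pushforward.
apply/eqP; rewrite eq_le measure_ge0 andbT.
rewrite [leRHS](_ : _ = (N01 \x chi2_law R m)%E (setT `*` [set q : RM | q < 0])); last first.
  by rewrite product_measure1E//= IHm mule0.
apply: le_measure; rewrite ?inE.
- exact: (measurable_preimageT (@measurable_add_sqr R) mlt).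
- exact: measurableX.
move=> [x y] /=; rewrite /add_sqr /= => h; split => //.
by rewrite (le_lt_trans _ h)// lerDr sqr_ge0.
Qed.

(** If [x^2 + y <= 0], then [y < 0] or [x = 0]. Splitting in this way puts the atom question on the
    normal component, as the law with 0 degrees of freedom does charge 0. *)
Lemma chi2_le0 m : (0 < m)%N -> chi2_law R m [set q : RM | q <= 0] = 0%E.
Proof.
case: m => // m _ /=; rewrite /distribution /pushforward.
have mlt : measurable [set q : RM | q < 0].
  by rewrite (_ : [set q | q < 0] = `]-oo, 0[%classic)//; apply/seteqP; split => q; rewrite /= in_itv.
have mle : measurable [set q : RM | q <= 0] by exact: measurable_leset.
apply/eqP; rewrite eq_le measure_ge0 andbT.
rewrite (@le_trans _ _ ((N01 \x chi2_law R m)%E ((setT `*` [set q : RM | q < 0]) `|` ([set 0] `*` setT))))//.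
  apply: le_measure; rewrite ?inE.
  - exact: (measurable_preimageT (@measurable_add_sqr R) mle).
  - by apply: measurableU; exact: measurableX.
  move=> [x y] /=; rewrite /add_sqr /= => h.
  have [y0|y0] := ltP y 0; [by left|right; split => //].
  apply/eqP; rewrite -sqrf_eq0 eq_le sqr_ge0 andbT (le_trans _ h)// lerDl//.
rewrite (le_trans (measureU2 _ _ _))//=; try exact: measurableX.
rewrite !product_measure1E//= chi2_lt0 mule0 add0e.
by rewrite [N01 _]normal_point mul0e.
Qed.

End chi2_null.

Lemma measure_eq_off_null d (T : measurableType d) (R : realType)
    (P : {measure set T -> \bar R}) (N A B : set T) :
  measurable N -> P N = 0%E -> measurable A -> measurable B ->
  (forall x, ~ N x -> A x <-> B x) -> P A = P B.
Proof.
move=> mN PN mA mB AB.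
have null C : measurable C -> P C = P (C `\` N).
  move=> mC; rewrite (measureDI P mC mN) [X in (_ + X)%E](_ : _ = 0%E) ?adde0//.
  by apply: (subset_measure0 (B := N)) => //; exact: measurableI.
rewrite (null A)// (null B)//; congr (P _).
by apply/seteqP; split => x [] /= h nx; split => //; apply/AB.
Qed.

Lemma adde_exchange (R : realType) (x y z e : \bar R) : z \is a fin_num ->
  (e = y + z -> x + y = e + (x - z))%E.
Proof. by move=> zf ->; rewrite addeCA addeK. Qed.

Lemma ge0_integrable d (T : measurableType d) (R : realType)
    (P : {measure set T -> \bar R}) (D : set T) (f : T -> \bar R) :
  measurable D -> measurable_fun D f -> (forall x, D x -> 0 <= f x)%E ->
  (\int[P]_(x in D) f x < +oo)%E -> P.-integrable D f.
Proof.
move=> mD mf f0 foo; apply/integrableP; split => //.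
by under eq_integral => x /set_mem Dx do rewrite gee0_abs ?f0//.
Qed.

(** The same set function as [joint_law], packaged as a probability so that finiteness and
    additivity are available. *)
Definition joint_prob (R : realType) (m : nat) :
    probability (measurableTypeR R * (measurableTypeR R * measurableTypeR R))%type R :=
  (chi2_law R m \x @normal2 R)%E.

Lemma joint_probE (R : realType) (m : nat) E : @joint_law R m E = @joint_prob R m E.
Proof. by []. Qed.

(** * The coverage event under the joint law *)

Section coverage_law.
Context {R : realType}.
Notation mu := (@lebesgue_measure R).
Notation phi := (normal_pdf (0 : R) 1).
Notation N01 := (normal_prob (0 : R) 1).
Local Notation RM := (measurableTypeR R).
Local Notation R3 := (RM * (RM * RM))%type.

Variables (n p : nat) (t : nat -> R) (alpha c rho : R).
Let m := (n - p)%N.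
Hypotheses (pn : (p < n)%N) (rho1 : `|rho| <= 1)
  (ht : student_law m `[(- t m), (t m)] = (1 - alpha)%:E).

Let sq := Num.sqrt (1 - rho ^+ 2).

Let rho2 : 0 <= 1 - rho ^+ 2.
Proof. by rewrite subr_ge0 -real_normK ?num_real// exprn_ile1. Qed.

Let sq2 : rho ^+ 2 + sq ^+ 2 = 1.
Proof. by rewrite sqr_sqrtr//; ring. Qed.

Let m0 : (0 < m)%N. Proof. by rewrite subn_gt0. Qed.

(* A point [(w, (z1, z2))] stands for [W = w], [z_l = z1], [z_o = z2];
   [full_event] and [reduced_event] say that I(emptyset) and I({p}) cover theta. *)
Definition full_event : set R3 :=
  [set x | `|rho * x.2.1 + sq * x.2.2| <= t m * x.1].

Definition reduced_event (g : R) : set R3 :=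
  [set x | `|sq * x.2.2 - rho * g| <= halfwidth2 n p t (x.2.1 + g) x.1 rho].

Definition rescale (x : R3) : R3 := (scaled m x.1, x.2).

Definition sel_event (g : R) : set R3 := [set x | `|x.2.1 + g| <= c * x.1].

Definition cover_event (g : R) : set R3 :=
  rescale @^-1` ((sel_event g `&` reduced_event g) `|` (~` sel_event g `&` full_event)).

Lemma measurable_full_event : measurable full_event.
Proof.
have m21 : measurable_fun setT (fun x : R3 => x.2.1 : RM) by exact: measurableT_comp.
have m22 : measurable_fun setT (fun x : R3 => x.2.2 : RM) by exact: measurableT_comp.
apply: measurable_leset; last exact: measurable_funM.
by apply: measurableT_comp => //; apply: measurable_funD; exact: measurable_funM.
Qed.

Lemma measurable_sel_event g : measurable (sel_event g).
Proof.
have m21 : measurable_fun setT (fun x : R3 => x.2.1 : RM) by exact: measurableT_comp.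
apply: measurable_leset; last exact: measurable_funM.
by apply: measurableT_comp => //; exact: measurable_funD.
Qed.

Lemma measurable_reduced_event g : measurable (reduced_event g).
Proof.
have m21 : measurable_fun setT (fun x : R3 => x.2.1 : RM) by exact: measurableT_comp.
have m22 : measurable_fun setT (fun x : R3 => x.2.2 : RM) by exact: measurableT_comp.
apply: measurable_leset.
  by apply: measurableT_comp => //; apply: measurable_funB => //; exact: measurable_funM.
apply: measurable_funM => //; apply: measurable_funM => //.
apply: (measurableT_comp measurable_sqrt).
apply: measurable_funM => //; apply: measurable_funD.
  by apply: measurable_funM => //; exact: (measurable_funX 2 measurable_fst).
by apply: (measurable_funX 2); exact: measurable_funD.
Qed.

Lemma measurable_rescale : measurable_fun setT rescale.
Proof.
apply: measurable_fun_pair => //.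
exact: (measurableT_comp (measurable_scaled m) measurable_fst).
Qed.

Lemma measurable_cover_event g : measurable (cover_event g).
Proof.
have h1 := measurable_full_event; have h2 := measurable_sel_event g.
have h3 := measurable_reduced_event g.
apply: (measurable_preimageT measurable_rescale).
by apply: measurableU; apply: measurableI => //; exact: measurableC.
Qed.

(** The combination [rho * z1 + sq * z2] is the first coordinate of a rotated pair, hence standard
    normal. *)
Lemma full_event_section (w : R) :
  @normal2 R [set z | full_event (w, z)] = N01 [set x | `|x| <= t m * w].
Proof.
have mI : measurable [set x : RM | `|x| <= t m * w] by exact: measurable_leset.
transitivity ((N01 \x N01)%E ([set x : RM | `|x| <= t m * w] `*` setT)).
  transitivity ((N01 \x N01)%E (rot rho (- sq) @^-1` ([set x : RM | `|x| <= t m * w] `*` setT))).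
    congr (product_measure1 _ _ _); apply/seteqP; split => z /=;
    by rewrite /full_event /rot /= mulNr opprK // => -[].
  by apply: normal2_rot; [rewrite sqrrN|exact: measurableX].
rewrite product_measure1E//= [X in (_ * X)%E](_ : _ = 1%E) ?mule1//.
exact: probability_setT.
Qed.

(** Off the null event [q <= 0], the inequality [|z| <= t m * scaled m q] bounds the Student ratio.
    The factors of the product are exchanged first, because [student_law] has the normal variable in
    front. *)
Lemma joint_full : @joint_law R m (rescale @^-1` full_event) = (1 - alpha)%:E.
Proof.
pose S := [set z : RM * RM | `|z.1| <= t m * scaled m z.2].
have mS : measurable S.
  apply: measurable_leset; first exact: measurableT_comp.
  apply: measurable_funM => //; exact: (measurableT_comp (measurable_scaled m) measurable_snd).
transitivity ((N01 \x chi2_law R m)%E S).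
  transitivity ((N01 \x^ chi2_law R m)%E S).
    rewrite /joint_law /product_measure1 /product_measure2.
    apply: eq_integral => q _ /=.
    transitivity (@normal2 R [set z | full_event (scaled m q, z)]).
      by congr (product_measure1 _ _ _); apply/seteqP; split => z /=; rewrite /xsection/= in_setE.
    rewrite full_event_section; congr (normal_prob _ _ _).
    by apply/seteqP; split => z /=; rewrite /ysection/= in_setE.
  apply/esym/product_measure_unique => // A B mA mB.
  exact: product_measure2E.
rewrite -ht /student_law /pushforward.
pose N : set (RM * RM) := setT `*` [set q : RM | q <= 0].
have mle : measurable [set q : RM | q <= 0] by exact: measurable_leset.
have mN : measurable N by exact: measurableX.
set B := _ @^-1` _.
(* On [N] the denominator is 0 and division by it gives 0, so [B] contains all or nothing of [N]
   according to whether the interval contains 0. *)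
have BE : B = (S `\` N) `|` (if - t m <= 0 <= t m then N else set0).
  apply/seteqP; split => -[x q]; rewrite /B /S /N /= in_itv/=.
    move=> h; have [q0|q0] := ltP 0 q.
      left; split; last by move=> [].
      have w0 : 0 < scaled m q by rewrite sqrtr_gt0 divr_gt0// ltr0n.
      move: h; rewrite -ler_norml normrM normfV -/(scaled m q) (gtr0_norm w0).
      by rewrite ler_pdivrMr.
    right; move: h; rewrite ler0_sqrtr ?invr0 ?mulr0.
      by move=> ->.
    by rewrite mulr_le0_ge0// invr_ge0.
  move=> [[h /not_andP[//|/negP]]|].
    rewrite -ltNge => q0.
    have w0 : 0 < scaled m q by rewrite sqrtr_gt0 divr_gt0// ltr0n.
    by rewrite -ler_norml normrM normfV -/(scaled m q) (gtr0_norm w0) ler_pdivrMr.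
  case: ifP => // h [_ q0]; rewrite ler0_sqrtr ?invr0 ?mulr0//.
  by rewrite mulr_le0_ge0// invr_ge0.
apply: (@measure_eq_off_null _ _ _ _ N) => //.
- transitivity (N01 setT * chi2_law R m [set q | (q <= 0)%R])%E.
    exact: product_measure1E.
  by rewrite [X in (_ * X)%E]chi2_le0// mule0.
- rewrite BE; apply: measurableU; first exact: measurableD.
  by case: ifP.
- move=> x Nx; rewrite BE; split; first by move=> Sx; left.
  by move=> [[]//|]; case: ifP.
Qed.

Lemma cover_split g : @joint_law R m (cover_event g) =
  ((1 - alpha)%:E + (@joint_law R m (rescale @^-1` (sel_event g `&` reduced_event g)) -
     @joint_law R m (rescale @^-1` (sel_event g `&` full_event))))%E.
Proof.
have ms : measurable (rescale @^-1` sel_event g).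
  exact: (measurable_preimageT measurable_rescale (measurable_sel_event g)).
have mf : measurable (rescale @^-1` full_event).
  exact: (measurable_preimageT measurable_rescale measurable_full_event).
have mr : measurable (rescale @^-1` reduced_event g).
  exact: (measurable_preimageT measurable_rescale (measurable_reduced_event g)).
have -> : cover_event g = (rescale @^-1` (sel_event g `&` reduced_event g)) `|`
    (rescale @^-1` full_event `\` rescale @^-1` sel_event g).
  by apply/seteqP; split => x /= [[? ?]|[? ?]]; [left|right|left|right].
have fin E : measurable E -> (@joint_prob R m) E \is a fin_num by exact: fin_num_measure.
rewrite !joint_probE measureU//=; last 3 first.
- exact: measurableI.
- exact: measurableD.
- by apply/seteqP; split => x //= [[? _] [_ ?]].
apply: adde_exchange; first by apply: fin; exact: measurableI.
by rewrite -joint_full joint_probE (measureDI _ mf ms) (setIC (_ @^-1` full_event)).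
Qed.

Lemma halfwidth2N h w : halfwidth2 n p t (- h) w rho = halfwidth2 n p t h w rho.
Proof. by rewrite /halfwidth2 sqrrN. Qed.

Lemma cover_even g : @joint_law R m (cover_event (- g)) = @joint_law R m (cover_event g).
Proof.
rewrite /joint_law {1 3}/product_measure1; apply: eq_integral => q _ /=.
rewrite -[RHS](@normal2_rot R (-1) 0); last 2 first.
- by rewrite sqrrN expr1n expr0n addr0.
- exact: (measurable_xsection q (measurable_cover_event g)).
congr (product_measure1 _ _ _); apply/seteqP.
have rE (z : RM * RM) : rot (-1) 0 z = (- z.1, - z.2).
  by rewrite /rot; congr pair; ring.
have E z : cover_event (- g) (q, z) = cover_event g (q, (- z.1, - z.2)).
  rewrite /cover_event /rescale /=.
  have -> : sel_event (- g) (scaled m q, z) = sel_event g (scaled m q, (- z.1, - z.2)).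
    by rewrite /sel_event /= -normrN opprB addrC.
  have -> : full_event (scaled m q, z) = full_event (scaled m q, (- z.1, - z.2)).
    by rewrite /full_event /= -normrN opprD !mulrN.
  have -> // : reduced_event (- g) (scaled m q, z) = reduced_event g (scaled m q, (- z.1, - z.2)).
  rewrite /reduced_event /= -halfwidth2N; congr (_ <= _).
    by rewrite -normrN; congr (`|_|); ring.
  by congr halfwidth2; ring.
by split => z /=; rewrite /xsection /= !in_setE E rE.
Qed.


Variable fW : R -> R.
Hypotheses (mfW : measurable_fun setT (fW : RM -> RM)) (fW0 : forall w, 0 <= fW w)
  (pdfW : forall A : set RM, measurable A ->
     chi2_law R m [set q | A (scaled m q)] = (\int[mu]_(w in A) (fW w)%:E)%E).

(** Given [z1], [G = rho * z1 + sq * z2] has mean [rho * z1] and variance [1 - rho^2]. With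
    [h = z1 + g], [sq * z2 - rho * g] is [G - rho * h], which explains the centre [rho * h] of
    [ell2] and [u2]. *)
Lemma reduced_kE g w z1 :
  N01 [set z2 | reduced_event g (w, (z1, z2))] = (k n p t (z1 + g) w g rho)%:E.
Proof.
rewrite /k PsiE//; congr (normal_prob _ _ _); apply/seteqP; split => z2;
rewrite /reduced_event /ell2 /u2 /= -/sq ler_norml => /andP[h1 h2];
by apply/andP; split; lra.
Qed.

Lemma full_kE g w z1 :
  N01 [set z2 | full_event (w, (z1, z2))] = (k_dagger n p t (z1 + g) w g rho)%:E.
Proof.
rewrite /k_dagger PsiE//; congr (normal_prob _ _ _); apply/seteqP; split => z2;
by rewrite /full_event /ell1 /u1 /= -/sq addrK ler_norml.
Qed.

Lemma cover_formula g : @joint_law R m (cover_event g) =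
  coverage_formula n p t alpha c fW g rho.
Proof.
rewrite cover_split /coverage_formula; congr (_ + _)%E.
pose kr h w := k n p t h w g rho; pose kf h w := k_dagger n p t h w g rho.
have mr := measurable_reduced_event g; have mf := measurable_full_event.
have j1 := joint_sel (kap := kr) c mr (reduced_kE g) mfW fW0 pdfW.
have j0 := joint_sel (kap := kf) c mf (full_kE g) mfW fW0 pdfW.
rewrite [X in (X - _ = _)%E]j1 [X in (_ - X = _)%E]j0.
(* To merge the two double integrals the outer integrands must be measurable and integrable;
   [sel_dens] gets this from [sel_mass], with which it agrees up to the factor [fW] for [w >= 0]. *)
pose s1 := sel_mass c g (reduced_event g); pose s0 := sel_mass c g full_event.
have d1 w : 0 <= w -> (s1 w * (fW w)%:E)%E = sel_dens c g kr fW w.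
  by move=> w0; exact: (sel_mass_dens (kap := kr) c mr (reduced_kE g) fW0 w0).
have d0 w : 0 <= w -> (s0 w * (fW w)%:E)%E = sel_dens c g kf fW w.
  by move=> w0; exact: (sel_mass_dens (kap := kf) c mf (full_kE g) fW0 w0).
have m1 : measurable_fun setT (s1 : RM -> \bar R).
  exact: measurable_sel_mass (measurable_reduced_event g).
have m0' : measurable_fun setT (s0 : RM -> \bar R).
  exact: measurable_sel_mass measurable_full_event.
have p1 w : (0 <= s1 w)%E by exact: sel_mass_ge0.
have p0 w : (0 <= s0 w)%E by exact: sel_mass_ge0.
clearbody s1 s0.
have inD w : (w \in `[0, +oo[%classic) -> 0 <= w by rewrite inE/= in_itv/= andbT.
have i1 : (\int[mu]_(w in `[0%R, +oo[) sel_dens c g kr fW w =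
    \int[mu]_(w in `[0%R, +oo[) (s1 w * (fW w)%:E))%E.
  by apply: eq_integral => w /inD w0; rewrite d1.
have i0 : (\int[mu]_(w in `[0%R, +oo[) sel_dens c g kf fW w =
    \int[mu]_(w in `[0%R, +oo[) (s0 w * (fW w)%:E))%E.
  by apply: eq_integral => w /inD w0; rewrite d0.
have mEf : measurable_fun setT (EFin \o fW) by exact/measurable_EFinP.
have ms1 : measurable_fun setT (fun w : RM => (s1 w * (fW w)%:E)%E).
  exact: (emeasurable_funM m1 mEf).
have ms0 : measurable_fun setT (fun w : RM => (s0 w * (fW w)%:E)%E).
  exact: (emeasurable_funM m0' mEf).
have le1 (E : set R3) : measurable E -> (@joint_law R m E < +oo)%E.
  move=> mE; rewrite joint_probE.
  by rewrite (le_lt_trans (probability_le1 _ mE))// ltry.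
have int1 : mu.-integrable `[0%R, +oo[ (fun w => s1 w * (fW w)%:E)%E.
  apply: ge0_integrable => [//||w _|]; first exact: measurable_funTS ms1.
    by rewrite mule_ge0 ?lee_fin.
  rewrite -i1 -j1; apply: le1.
  exact: (measurable_preimageT measurable_rescale
    (measurableI _ _ (measurable_sel_event g) mr)).
have int0 : mu.-integrable `[0%R, +oo[ (fun w => s0 w * (fW w)%:E)%E.
  apply: ge0_integrable => [//||w _|]; first exact: measurable_funTS ms0.
    by rewrite mule_ge0 ?lee_fin.
  rewrite -i0 -j0; apply: le1.
  exact: (measurable_preimageT measurable_rescale
    (measurableI _ _ (measurable_sel_event g) mf)).
rewrite i1.
rewrite i0.
have mD : measurable (`[0, +oo[%classic : set RM) by [].
rewrite -[LHS](integralB mD int1 int0).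
apply: eq_integral => w /inD w0.
(* The inner integral is finite because it equals a probability times [fW w]. *)
have intd F kap (mF : measurable F) (kapE : forall w z1 : RM,
    N01 [set z2 | F (w, (z1, z2))] = (kap (z1 + g) w)%:E) :
    mu.-integrable `[- c, c] (fun x : RM => (kap (w * x) w * phi (w * x - g) * w * fW w)%:E).
  apply: ge0_integrable => //.
  - apply/measurable_funTS/measurable_EFinP; apply: measurable_funM => //.
    exact: measurable_dens mF kapE w.
  - by move=> x _; rewrite lee_fin !mulr_ge0 ?normal_pdf_ge0// (kap_ge0 kapE).
  - rewrite -/(sel_dens c g kap fW w) -(sel_mass_dens c mF kapE fW0 w0).
    rewrite ltey_eq fin_numM//.
    have : @normal2 R [set z | `|z.1 + g| <= c * w /\ F (w, z)] \is a fin_num.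
      apply: fin_num_measure; apply: measurableI.
        by apply: measurable_leset => //; apply: measurableT_comp => //; exact: measurable_funD.
      apply: measurable_preimageT => //; exact: measurable_fun_pair.
    by [].
rewrite d1// d0//; rewrite -integralB_EFin//.
- by apply: eq_integral => x _; rewrite -EFinB -!mulrBl.
- exact: (intd _ kr mr (reduced_kE g)).
- exact: (intd _ kf mf (full_kE g)).
Qed.

End coverage_law.

(** * Ties between the two candidates *)

Section ties.
Context {R : realType}.
Notation N01 := (normal_prob (0 : R) 1).
Local Notation RM := (measurableTypeR R).
Local Notation R3 := (RM * (RM * RM))%type.

(* [x.1 <= 0] is included because T, the AIC and C criteria and the Student
   ratio have junk values when RSS = 0. *)
Definition tie_event (m : nat) (c g : R) : set R3 :=
  [set x | `|x.2.1 + g| = c * scaled m x.1] `|` [set x | x.1 <= 0].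

Lemma measurable_tie_event m c g : measurable (tie_event m c g).
Proof.
have m21 : measurable_fun setT (fun x : R3 => x.2.1 : RM) by exact: measurableT_comp.
apply: measurableU; last exact: measurable_leset.
apply: measurable_eqset.
  by apply: measurableT_comp => //; exact: measurable_funD.
apply: measurable_funM => //.
exact: (measurableT_comp (measurable_scaled m) measurable_fst).
Qed.

(** For a fixed chi-squared value a tie confines [z1] to two points, which the normal law does not
    charge. *)
Lemma tie_event_null m c g : (0 < m)%N -> @joint_law R m (tie_event m c g) = 0%E.
Proof.
move=> m0; rewrite joint_probE.
have m21 : measurable_fun setT (fun x : R3 => x.2.1 : RM) by exact: measurableT_comp.
have mT : measurable [set x : R3 | `|x.2.1 + g| = c * scaled m x.1].
  apply: measurable_eqset.
    by apply: measurableT_comp => //; exact: measurable_funD.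
  apply: measurable_funM => //.
  exact: (measurableT_comp (measurable_scaled m) measurable_fst).
have mq : measurable [set q : RM | q <= 0] by exact: measurable_leset.
have mL : measurable [set x : R3 | x.1 <= 0].
  exact: (measurable_preimageT measurable_fst mq).
apply/eqP; rewrite eq_le measure_ge0 andbT.
rewrite (le_trans (measureU2 _ mT mL))//.
rewrite [X in (_ + X)%E](_ : _ = 0%E); last first.
  rewrite (_ : [set x | _] = [set q : RM | q <= 0] `*` setT).
    transitivity (chi2_law R m [set q | (q <= 0)%R] * @normal2 R setT)%E.
      exact: product_measure1E.
    by rewrite chi2_le0// mul0e.
  by apply/seteqP; split => x //= [].
rewrite adde0 [leLHS](_ : _ = 0%E)//.
rewrite /joint_prob /= {1}/product_measure1 integral0_eq// => q _ /=.
set V := xsection _ _.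
have mV : measurable V by exact: measurable_xsection.
pose w := c * scaled m q.
pose F : set RM := [set (w - g)] `|` [set (- w - g)].
have F0 : N01 F = 0%E.
  apply/eqP; rewrite eq_le measure_ge0 andbT.
  rewrite (le_trans (measureU2 _ _ _))//=; try exact: measurable_set1.
  by rewrite !normal_point adde0.
have mF : measurable F by apply: measurableU; exact: measurable_set1.
suff : @normal2 R V = 0%E by [].
apply: (subset_measure0 (B := F `*` setT)) => //; first exact: measurableX.
  move=> z; rewrite /V /xsection /= in_setE /= => h; split => //; rewrite /F /=.
  have [s|s] := leP 0 (z.1 + g).
    by left; move: h; rewrite ger0_norm// -/w; lra.
  by right; move: h; rewrite ltr0_norm// -/w; lra.
transitivity (N01 F * N01 setT)%E; first exact: product_measure1E.
by rewrite F0 mul0e.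
Qed.

Lemma scaled_sqr m (q : R) : (0 < m)%N -> 0 <= q -> m%:R * scaled m q ^+ 2 = q.
Proof.
move=> m0 q0; have mR : (m%:R : R) != 0 by rewrite pnatr_eq0 -lt0n.
by rewrite sqr_sqrtr ?divr_ge0// mulrC divfK.
Qed.

Lemma le_norm_sqr (h c w : R) : 0 <= c -> 0 <= w -> (`|h| <= c * w) = (h ^+ 2 <= (c * w) ^+ 2).
Proof. by move=> c0 w0; rewrite -ler_sqr ?nnegrE ?mulr_ge0// real_normK ?num_real. Qed.

Lemma ge_norm_sqr (h c w : R) : 0 <= c -> 0 <= w -> (c * w <= `|h|) = ((c * w) ^+ 2 <= h ^+ 2).
Proof. by move=> c0 w0; rewrite -ler_sqr ?nnegrE ?mulr_ge0// real_normK ?num_real. Qed.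

End ties.

Section formula_even.
Context {R : realType} (n p : nat) (t : nat -> R).

Lemma k_rhoN h w g r0 : `|r0| <= 1 -> k n p t h w g (- r0) = k n p t h w g r0.
Proof.
move=> r1; have r2 : 0 <= 1 - r0 ^+ 2 by rewrite subr_ge0 -real_normK ?num_real// exprn_ile1.
rewrite /k -[RHS](PsiN _ _ _ r2) sqrrN; congr (Psi _ _ _ _);
  by rewrite /ell2 /u2 /halfwidth2 ?sqrrN; ring.
Qed.

Lemma k_dagger_rhoN h w g r0 : `|r0| <= 1 ->
  k_dagger n p t h w g (- r0) = k_dagger n p t h w g r0.
Proof.
move=> r1; have r2 : 0 <= 1 - r0 ^+ 2 by rewrite subr_ge0 -real_normK ?num_real// exprn_ile1.
rewrite /k_dagger -[RHS](PsiN _ _ _ r2) sqrrN; congr (Psi _ _ _ _);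
  by rewrite /ell1 /u1; ring.
Qed.

Lemma coverage_formula_rhoN alpha c fW g r0 : `|r0| <= 1 ->
  coverage_formula n p t alpha c fW g (- r0) = coverage_formula n p t alpha c fW g r0.
Proof.
move=> r1.
pose f r w x := ((k n p t (w * x) w g r - k_dagger n p t (w * x) w g r) *
  normal_pdf 0 1 (w * x - g) * w * fW w)%:E.
have fE : f (- r0) = f r0.
  apply/funext => w; apply/funext => x; rewrite /f.
  by rewrite (k_rhoN _ _ _ r1) (k_dagger_rhoN _ _ _ r1).
pose F f := ((1 - alpha)%:E + \int[@lebesgue_measure R]_(w in `[0%R, +oo[)
  \int[@lebesgue_measure R]_(x in `[(- c)%R, c]) f w x)%E.
exact: (congr1 F fE).
Qed.

End formula_even.

(** * Events and selection rules *)

(** Each comparison of criteria below is a positive multiple of a comparison of squares. Both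
    directions are kept because either candidate may be the minimizer. *)
Lemma le_scale (R : realFieldType) (k x y a b : R) : 0 < k -> x - y = k * (a - b) ->
  (y <= x) = (b <= a) /\ (x <= y) = (a <= b).
Proof.
move=> k0 e; split; rewrite -subr_ge0 -[RHS]subr_ge0.
  by rewrite e pmulr_rge0.
by rewrite -(opprB x) e -mulrN opprB pmulr_rge0.
Qed.

Section selection.
Context {R : realType} (n p : nat) (pn : (p <= n)%N) (X : 'M[R]_(n, p)) (a : 'cV[R]_p).
Variables (l o : 'I_p) (U : 'M[R]_n) (r c0 c1 : R).
Hypotheses (rX : \rank X = p) (cf : canonical_form pn X a l o U r c0 c1)
  (r0 : 0 < r) (c00 : 0 <= c0) (ol : o != l) (a0 : a != 0) (np : (p < n)%N).
Variable M : gauss_model X.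
Variable t : nat -> R.

Let m := (n - p)%N.
Let m0 : (0 < m)%N. Proof. by rewrite subn_gt0. Qed.
Let mR : 0 < m%:R :> R. Proof. by rewrite ltr0n. Qed.

Notation s := (sigma M).
Let s0 : 0 < s. Proof. exact: sigma_gt0. Qed.
Let S := sum_sqr (zcoord U (M := M)) (tail_idx n p).
Let zl := zcoord U (M := M) (widen_ord pn l).
Let zo := zcoord U (M := M) (widen_ord pn o).
Let g := gamma M l.
Let sv := Num.sqrt (c0 ^+ 2 + c1 ^+ 2).
Let rho0 := c1 / sv.

Let sv0 : 0 < sv. Proof. by rewrite sqrtr_gt0 (c0c1_gt0 cf). Qed.
Let sv2 : sv ^+ 2 = c0 ^+ 2 + c1 ^+ 2.
Proof. by rewrite sqr_sqrtr// ltW// (c0c1_gt0 cf). Qed.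
Let S0 w : 0 <= S w.
Proof. by apply: sumr_ge0 => i _; rewrite sqr_ge0. Qed.

Lemma sqrt_rho0 : Num.sqrt (1 - rho0 ^+ 2) = c0 / sv.
Proof.
have -> : 1 - rho0 ^+ 2 = (c0 / sv) ^+ 2.
  have svN0 : sv != 0 by rewrite gt_eqF.
  by rewrite /rho0 !expr_div_n sv2; field; rewrite -sv2 expf_neq0.
by rewrite sqrtr_sqr ger0_norm// divr_ge0// ltW.
Qed.

Lemma rho0_le1 : `|rho0| <= 1.
Proof.
rewrite normrM normfV (gtr0_norm sv0) ler_pdivrMr// mul1r.
by rewrite -ler_sqr ?nnegrE ?(ltW sv0)// real_normK ?num_real// sv2 lerDr sqr_ge0.
Qed.

Let blE : r * beta M l 0 = s * g.
Proof. by rewrite /g (gammaE rX cf r0 ol); field; rewrite gt_eqF. Qed.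

Lemma CI_full w : CI (M := M) a t finset.set0 w (theta M a) <->
  full_event n p t rho0 (scaled m (S w), (zl w, zo w)).
Proof.
rewrite /CI /= in_itv/= -ler_distl /full_event /= sqrt_rho0.
rewrite /S_ (RSS0E rX cf r0) finset.cards0 addn0 (vK0E rX cf r0 ol) -/sv.
rewrite -/S -/m -/(S w) (_ : Num.sqrt (s ^+ 2 * S w / m%:R) = s * scaled m (S w)); last first.
  by rewrite -mulrA sqrtrM ?sqr_ge0// sqrtr_sqr (gtr0_norm s0).
rewrite (Theta0E rX cf r0) distrC -/(zl w) -/(zo w).
have -> : theta M a + c1 * s * zl w + c0 * s * zo w - theta M a =
   (s * sv) * (rho0 * zl w + c0 / sv * zo w).
  by rewrite /rho0; field; rewrite gt_eqF.
rewrite normrM gtr0_norm ?mulr_gt0//.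
have -> : t m * (s * scaled m (S w)) * sv = (s * sv) * (t m * scaled m (S w)) by ring.
by rewrite ler_pM2l// mulr_gt0.
Qed.

Lemma RSS_reduced w : RSS X [set l]%SET (Y (M := M) w) =
  s ^+ 2 * (m%:R * scaled m (S w) ^+ 2 + (zl w + g) ^+ 2).
Proof. by rewrite (RSS1E rX cf r0) scaled_sqr// blE /S /zl; ring. Qed.

Lemma RSS_full w : RSS X finset.set0 (Y (M := M) w) =
  s ^+ 2 * (m%:R * scaled m (S w) ^+ 2).
Proof. by rewrite (RSS0E rX cf r0) scaled_sqr. Qed.

(** Everything is divided by [s * sv], the standard deviation of the unrestricted estimator: the
    coefficient [c0] becomes [sqrt (1 - rho0^2)] and the bias becomes [- rho0 * g]. *)
Lemma CI_reduced w : CI (M := M) a t [set l]%SET w (theta M a) <->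
  reduced_event n p t rho0 g (scaled m (S w), (zl w, zo w)).
Proof.
rewrite /CI /= in_itv/= -ler_distl /reduced_event /= /halfwidth2 sqrt_rho0.
rewrite /S_ RSS_reduced finset.cards1 (vK1E rX cf r0 ol).
rewrite sqrtr_sqr (ger0_norm c00) -/m.
have sE (A B : R) : Num.sqrt (s ^+ 2 * A / B) = s * Num.sqrt (A / B).
  by rewrite -mulrA sqrtrM ?sqr_ge0// sqrtr_sqr (gtr0_norm s0).
rewrite sE (Theta1E rX cf r0 ol) blE distrC -/(zo w) -/(zl w).
have -> : theta M a - c1 * (s * g) + 0 * zl w + c0 * s * zo w - theta M a =
   (s * sv) * (c0 / sv * zo w - rho0 * g).
  by rewrite /rho0; field; rewrite gt_eqF.
rewrite normrM gtr0_norm ?mulr_gt0//.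
set A := Num.sqrt _.
have -> : t (m + 1)%N * (s * A) * c0 = (s * sv) * (t (m + 1)%N * A * (c0 / sv)).
  by field; rewrite gt_eqF.
by rewrite ler_pM2l// mulr_gt0.
Qed.


Let Yw := Y (M := M).

(** With [e = exp (2 f / n)] the difference of the criteria is [n (ln R1 - ln (R0 e))], and
    [R1 - R0 e] is [s^2 (h^2 - (e - 1) m W^2)]: this is the origin of [d]. *)
Lemma AIC_critE (pen : penalty) w : 0 < S w ->
  let c := cutoff n p (MinAIC R pen) in
  let h := zl w + g in let W := scaled m (S w) in
  (AIC_crit X pen (Yw w) [set l]%SET <= AIC_crit X pen (Yw w) finset.set0) =
    (h ^+ 2 <= (c * W) ^+ 2) /\
  (AIC_crit X pen (Yw w) finset.set0 <= AIC_crit X pen (Yw w) [set l]%SET) =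
    ((c * W) ^+ 2 <= h ^+ 2).
Proof.
move=> Sw c h W.
have W0 : 0 < W by rewrite sqrtr_gt0 divr_gt0.
have n0 : 0 < n%:R :> R by rewrite ltr0n (leq_trans _ np).
have f0 : 0 <= penalty_factor R pen n.
  by case: (pen) => //=; rewrite mulr_ge0 ?ln_ge0// ler1n (leq_trans _ np).
set f := penalty_factor R pen n in f0 *.
set e := expR (2 * f / n%:R).
have e1 : 1 <= e by rewrite -[leLHS]expR0 ler_expR divr_ge0 ?mulr_ge0// ltW.
have c2 : c ^+ 2 = (e - 1) * m%:R.
  by rewrite sqr_sqrtr// mulr_ge0 ?subr_ge0// ltW.
set R1 := RSS X [set l]%SET (Yw w); set R0 := RSS X finset.set0 (Yw w).
have R0E : R0 = s ^+ 2 * (m%:R * W ^+ 2) by exact: RSS_full.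
have R1E : R1 = s ^+ 2 * (m%:R * W ^+ 2 + h ^+ 2) by exact: RSS_reduced.
have R0p : 0 < R0 by rewrite R0E !mulr_gt0// exprn_gt0.
have R1p : 0 < R1.
  by rewrite R1E mulr_gt0 ?exprn_gt0// ltr_wpDr ?sqr_ge0// mulr_gt0// exprn_gt0.
have Re : 0 < R0 * e by rewrite mulr_gt0// (lt_le_trans _ e1).
have p0 : (0 < p)%N by rewrite (leq_trans _ (ltn_ord l)).
have [<- <-] : (R1 <= R0 * e) = (h ^+ 2 <= (c * W) ^+ 2) /\
    (R0 * e <= R1) = ((c * W) ^+ 2 <= h ^+ 2).
  apply: (@le_scale _ (s ^+ 2)); first by rewrite exprn_gt0.
  by rewrite R0E R1E exprMn c2; ring.
have [<- <-] : (ln R1 <= ln (R0 * e)) = (R1 <= R0 * e) /\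
    (ln (R0 * e) <= ln R1) = (R0 * e <= R1) by rewrite !ler_ln.
apply: (@le_scale _ n%:R) => //.
rewrite /AIC_crit -/R1 -/R0 -/f finset.cards1 finset.cards0 subn0 natrB//.
rewrite lnM ?posrE//; last by rewrite (lt_le_trans _ e1).
by rewrite /e expRK; field; rewrite gt_eqF.
Qed.

(** [RSS / (n - p)] is [s^2 W^2], so the criteria differ by [h^2 / W^2 - 2]. *)
Lemma C_critE w : 0 < S w ->
  let c := cutoff n p (@MinC R) in
  let h := zl w + g in let W := scaled m (S w) in
  (C_crit X (Yw w) [set l]%SET <= C_crit X (Yw w) finset.set0) =
    (h ^+ 2 <= (c * W) ^+ 2) /\
  (C_crit X (Yw w) finset.set0 <= C_crit X (Yw w) [set l]%SET) =
    ((c * W) ^+ 2 <= h ^+ 2).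
Proof.
move=> Sw c h W.
have W0 : 0 < W by rewrite sqrtr_gt0 divr_gt0.
have c2 : c ^+ 2 = 2 by rewrite sqr_sqrtr.
have p0 : (0 < p)%N by rewrite (leq_trans _ (ltn_ord l)).
apply: (@le_scale _ (W ^+ 2)^-1); first by rewrite invr_gt0 exprn_gt0.
rewrite /C_crit [RSS X finset.set0 _]RSS_full [RSS X [set l]%SET _]RSS_reduced.
rewrite finset.cards1 finset.cards0 subn0 (natrB _ p0) exprMn c2 -/W -/h -/m.
by field; rewrite !gt_eqF.
Qed.

(** The criteria differ by [s^2 (h^2 - W^2) / (m + 1)]. *)
Lemma B_critE w : 0 < S w ->
  let c := cutoff n p (@MinB R) in
  let h := zl w + g in let W := scaled m (S w) in
  (B_crit X (Yw w) [set l]%SET <= B_crit X (Yw w) finset.set0) =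
    (h ^+ 2 <= (c * W) ^+ 2) /\
  (B_crit X (Yw w) finset.set0 <= B_crit X (Yw w) [set l]%SET) =
    ((c * W) ^+ 2 <= h ^+ 2).
Proof.
move=> Sw c h W.
apply: (@le_scale _ (s ^+ 2 / (m%:R + 1))).
  by rewrite divr_gt0 ?exprn_gt0// addr_gt0.
rewrite /B_crit [RSS X finset.set0 _]RSS_full [RSS X [set l]%SET _]RSS_reduced.
rewrite finset.cards1 finset.cards0 addn0 natrD -/W -/h -/m /c /= mul1r.
by field; rewrite !gt_eqF// addr_gt0.
Qed.

Lemma T_statE w : 0 < S w -> `|T_stat (M := M) l w| = `|zl w + g| / scaled m (S w).
Proof.
move=> Sw; have W0 : 0 < scaled m (S w) by rewrite sqrtr_gt0 divr_gt0.
rewrite /T_stat RSS_full (beta_hatE rX cf r0) (sqrt_v22E rX cf r0 ol) -/(zl w) -/m.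
have -> : s ^+ 2 * (m%:R * scaled m (S w) ^+ 2) / m%:R = (s * scaled m (S w)) ^+ 2.
  by field; rewrite gt_eqF.
rewrite sqrtr_sqr (gtr0_norm (mulr_gt0 s0 W0)).
have -> : (beta M l 0 + s / r * zl w + 0 * zcoord U (widen_ord pn o) w) /
   (s * scaled m (S w) / r) = (zl w + r * beta M l 0 / s) / scaled m (S w).
  by field; rewrite !gt_eqF.
by rewrite blE mulrAC divff ?gt_eqF// mul1r normrM normfV (gtr0_norm W0).
Qed.

Lemma cutoff_ge0 rule : valid_rule rule -> 0 <= cutoff (R := R) n p rule.
Proof. by case: rule => [pen||//|d /ltW]//= _; rewrite ?sqrtr_ge0. Qed.

(** Both inequalities are weak: at equality an arbitrary minimizer may go either way, so nothing
    stronger holds pointwise. *)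
Lemma chosen_cases rule Kstar w : valid_rule rule ->
  chosen_by (M := M) l rule Kstar -> 0 < S w ->
  (Kstar w = [set l]%SET /\ `|zl w + g| <= cutoff n p rule * scaled m (S w)) \/
  (Kstar w = finset.set0 /\ cutoff n p rule * scaled m (S w) <= `|zl w + g|).
Proof.
move=> vr ch Sw.
have W0 : 0 < scaled m (S w) by rewrite sqrtr_gt0 divr_gt0.
rewrite le_norm_sqr ?ge_norm_sqr ?cutoff_ge0 ?(ltW W0)//.
have minC crit : minimizes (candidates l) crit (Kstar w) ->
    (crit [set l]%SET <= crit finset.set0) =
      ((zl w + g) ^+ 2 <= (cutoff n p rule * scaled m (S w)) ^+ 2) /\
    (crit finset.set0 <= crit [set l]%SET) =
      ((cutoff n p rule * scaled m (S w)) ^+ 2 <= (zl w + g) ^+ 2) ->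
    (Kstar w = [set l]%SET /\
       (zl w + g) ^+ 2 <= (cutoff n p rule * scaled m (S w)) ^+ 2) \/
    (Kstar w = finset.set0 /\
       (cutoff n p rule * scaled m (S w)) ^+ 2 <= (zl w + g) ^+ 2).
  move=> [Kin Kmin] [<- <-]; move: Kin; rewrite finset.in_set2 => /orP[] /eqP K.
    by left; split => //; rewrite -K; apply: Kmin; rewrite finset.in_set2 eqxx orbT.
  by right; split => //; rewrite -K; apply: Kmin; rewrite finset.in_set2 eqxx.
case: rule vr ch minC => [pen||  |d] vr ch minC.
- exact: minC (ch w) (AIC_critE pen Sw).
- exact: minC (ch w) (C_critE Sw).
- exact: minC (ch w) (B_critE Sw).
rewrite -le_norm_sqr -?ge_norm_sqr ?cutoff_ge0 ?(ltW W0)//=.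
rewrite (ch w) T_statE// ler_pdivlMr//; case: ifP => h; first by right.
by left; split => //; rewrite ltW// ltNge h.
Qed.

End selection.

(** * Transfer from the model to the joint law *)

Section coverage.
Context {R : realType} (n p : nat) (pn : (p <= n)%N) (X : 'M[R]_(n, p)) (a : 'cV[R]_p).
Variables (l o : 'I_p) (U : 'M[R]_n) (r c0 c1 : R).
Hypotheses (rX : \rank X = p) (cf : canonical_form pn X a l o U r c0 c1)
  (r0 : 0 < r) (c00 : 0 <= c0) (ol : o != l) (a0 : a != 0) (np : (p < n)%N).
Variable M : gauss_model X.
Variables (t : nat -> R) (rule : selection_rule R).
Hypothesis vr : valid_rule rule.

Local Notation RM := (measurableTypeR R).
Let m := (n - p)%N.
Let m0 : (0 < m)%N. Proof. by rewrite subn_gt0. Qed.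
Let S := sum_sqr (zcoord U (M := M)) (tail_idx n p).
Let zl := zcoord U (M := M) (widen_ord pn l).
Let zo := zcoord U (M := M) (widen_ord pn o).
Let g := gamma M l.
Let rho0 := c1 / Num.sqrt (c0 ^+ 2 + c1 ^+ 2).
Let c := cutoff n p rule.
Let zi : std_iid (Pr M) (zcoord U (M := M)). Proof. exact: zcoord_iid cf M. Qed.

Let point w : RM * (RM * RM) := (S w, (zl w, zo w)).

Let mpoint : measurable_fun setT point.
Proof.
have [mz _] := zi; apply: measurable_fun_pair; first exact: (measurable_sum_sqr zi).
by apply: measurable_fun_pair; exact: mz.
Qed.

(** The degrees of freedom of [RSS], counted by splitting a sum of ones at [p]. *)
Lemma size_tail_idx : size (tail_idx n p) = m.
Proof.
have e := sum_pn pn (fun=> (1 : R)).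
have e2 : \sum_(i < n | (p <= i)%N) (1 : R) = (size (tail_idx n p))%:R.
  by rewrite -sum1_size big_filter big_enum_cond natr_sum.
apply/eqP; rewrite -(@eqr_nat R) natrB//; apply/eqP.
by move: e; rewrite e2 sumr_const card_ord sumr_const card_ord => ->; rewrite addrAC subrr add0r.
Qed.

Lemma point_law (E : set (RM * (RM * RM))) : measurable E ->
  Pr M [set w | E (point w)] = @joint_law R m E.
Proof.
move=> mE; rewrite -size_tail_idx; apply: joint_lawE => //.
- by rewrite filter_uniq// enum_uniq.
- by apply: contra ol => /eqP /(congr1 val) /= h; apply/eqP/val_inj.
- by rewrite mem_filter /= leqNgt ltn_ord.
- by rewrite mem_filter /= leqNgt ltn_ord.
Qed.

Lemma chosen_mem Kstar w : chosen_by (M := M) l rule Kstar ->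
  Kstar w = [set l]%SET \/ Kstar w = finset.set0.
Proof.
have candE K : K \in candidates l -> K = [set l]%SET \/ K = finset.set0.
  by rewrite finset.in_set2 => /orP[] /eqP; [left|right].
case: rule => [pen||  |d] /= /(_ w); try by move=> [/candE].
by move=> ->; case: ifP; [right|left].
Qed.

Lemma coverageE Kstar : selects (M := M) l rule Kstar ->
  coverage a t Kstar = @joint_law R m (cover_event n p t c rho0 g).
Proof.
move=> [mK ch]; have mC := measurable_cover_event n p t c rho0 g.
rewrite -point_law// /coverage.
have mT := measurable_tie_event m c g.
have mred : measurable (point @^-1` (rescale n p @^-1` reduced_event n p t rho0 g)).
  exact: (measurable_preimageT mpoint (measurable_preimageT (measurable_rescale n p)
    (measurable_reduced_event n p t rho0 g))).
have mful : measurable (point @^-1` (rescale n p @^-1` full_event n p t rho0)).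
  exact: (measurable_preimageT mpoint (measurable_preimageT (measurable_rescale n p)
    (measurable_full_event n p t rho0))).
apply: (@measure_eq_off_null _ _ _ _ (point @^-1` tie_event m c g)).
- exact: measurable_preimageT mpoint mT.
- exact: (etrans (point_law mT) (tie_event_null c g m0)).
(* The coverage event is measurable because it splits along the measurable fibres of [Kstar], on
   each of which it is an explicit event in [point]. *)
- rewrite (_ : [set w | _] =
    ([set w | Kstar w = [set l]%SET] `&` point @^-1` (rescale n p @^-1` reduced_event n p t rho0 g)) `|`
    ([set w | Kstar w = finset.set0] `&` point @^-1` (rescale n p @^-1` full_event n p t rho0))).
    by apply: measurableU; apply: measurableI.
  apply/seteqP; split => w /=.
    case: (chosen_mem w ch) => ->; first by move=> /(CI_reduced rX cf r0 c00 ol a0 np); left.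
    by move=> /(CI_full rX cf r0 c00 ol a0); right.
  by case=> -[-> h]; [apply/(CI_reduced rX cf r0 c00 ol a0 np)|apply/(CI_full rX cf r0 c00 ol a0)].
- exact: measurable_preimageT mpoint mC.
move=> w /= /not_orP[tieN SN].
have Sw : 0 < S w by rewrite ltNge; apply/negP.
case: (chosen_cases rX cf r0 ol np vr ch Sw) => -[-> h].
  split=> [/(CI_reduced rX cf r0 c00 ol a0 np) hr|]; first by left.
  by case=> -[hs h2]; [apply/(CI_reduced rX cf r0 c00 ol a0 np)|case: hs].
split=> [/(CI_full rX cf r0 c00 ol a0) hr|].
  (* The two opposite weak inequalities would amount to a tie. *)
  right; split => // hs; apply: tieN; apply/eqP.
  by rewrite eq_le h andbT.
case=> -[hs h2]; last by apply/(CI_full rX cf r0 c00 ol a0).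
by exfalso; apply: tieN; apply/eqP; rewrite eq_le h andbT.
Qed.

Lemma WE w : W M w = scaled m (S w).
Proof.
rewrite /W (RSS0E rX cf r0) -/(S w) -/m /scaled; congr (Num.sqrt _).
by field; rewrite pnatr_eq0 -lt0n m0 gt_eqF// sigma_gt0.
Qed.

(** A density of [W] in the model is turned into a density of the image of the chi-squared law under
    [scaled m], the form assumed by [cover_formula]. *)
Lemma chi2_pdf fW : is_pdf (Pr M) (W M) fW -> forall A : set RM, measurable A ->
  chi2_law R m [set q | A (scaled m q)] = (\int[@lebesgue_measure R]_(w in A) (fW w)%:E)%E.
Proof.
move=> [mf f0 fE] A mA; rewrite -fE//.
have mA' : measurable [set q : RM | A (scaled m q)].
  exact: (measurable_preimageT (measurable_scaled m) mA).
transitivity (@joint_law R m ([set q : RM | A (scaled m q)] `*` setT)).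
  transitivity (chi2_law R m [set q : RM | A (scaled m q)] * @normal2 R setT)%E; last first.
    exact: esym (product_measure1E (chi2_law R m) (@normal2 R) mA' measurableT).
  by rewrite probability_setT mule1.
rewrite -point_law; last exact: measurableX.
congr (Pr M _); apply/seteqP; split => w /=; rewrite WE; first by case.
by move=> h; split.
Qed.

End coverage.

Theorem theorem3 (R : realType) (n p q : nat) (X : 'M[R]_(n, p))
    (a : 'cV[R]_p) (alpha : R) (t : nat -> R) (l : 'I_p)
    (r : selection_rule R)
    (hX : \rank X = p) (hnp : (p < n)%N) (ha : a != 0)
    (halpha : 0 < alpha < 1) (hq : (1 <= q < p)%N)
    (ht : forall m : nat, (0 < m)%N ->
       student_law m `[(- t m), (t m)] = (1 - alpha)%:E)
    (hl : l.+1 = p) (hr : valid_rule r) :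
  (exists cp : R -> R,
     (forall g : R, cp (- g) = cp g) /\
     forall (M : gauss_model X) (Kstar : Omega M -> {set 'I_p}),
       last_max_corr M a q l -> selects l r Kstar ->
       coverage a t Kstar = (cp (gamma M l))%:E /\
       forall fW : R -> R, is_pdf (Pr M) (W M) fW ->
         coverage a t Kstar =
           coverage_formula n p t alpha (cutoff n p r) fW
             (gamma M l) (rho M a l)) /\
  (forall (M : gauss_model X) (fW : R -> R),
     is_pdf (Pr M) (W M) fW ->
     forall g r0 : R, `|r0| <= 1 ->
       coverage_formula n p t alpha (cutoff n p r) fW g (- r0) =
       coverage_formula n p t alpha (cutoff n p r) fW g r0).
Proof.
split; last by move=> M fW _ g r0; exact: coverage_formula_rhoN.
have pn : (p <= n)%N := ltnW hnp.
have [q1 qp] := andP hq.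
(* The auxiliary coordinate is index 0; it differs from the last index because [1 <= q < p] forces
   [p >= 2]. *)
pose o : 'I_p := Ordinal (leq_ltn_trans (leq0n q) qp).
have ol : o != l.
  by rewrite -val_eqE /= eq_sym -lt0n -ltnS hl (leq_ltn_trans q1).
have [U [d [c0 [c1 [cf d0 c00]]]]] := canonical_form_pos pn a hX hl ol.
pose rho0 := c1 / Num.sqrt (c0 ^+ 2 + c1 ^+ 2).
have rho1 : `|rho0| <= 1 by exact: rho0_le1 cf ha.
(* The canonical form is chosen before any model, so this function of [g] is the same for all of
   them. *)
pose cp g := @joint_prob R (n - p) (cover_event n p t (cutoff n p r) rho0 g).
exists (fun g => fine (cp g)); split.
  by move=> g; rewrite /cp -!joint_probE cover_even.
move=> M Kstar _ sel; have covE := coverageE hX cf d0 c00 ol ha hnp t hr sel.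
split.
  rewrite covE fineK//; apply: fin_num_measure; exact: measurable_cover_event.
move=> fW pdf; have [mf f0 _] := pdf.
rewrite covE (rhoE hX cf d0 ol ha).
apply: cover_formula => //.
- by apply: ht; rewrite subn_gt0.
- exact: (chi2_pdf hX cf d0 ol hnp pdf).
Qed.
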